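(* Let $K$ be a compact Hausdorff space and $X$ be a Banach space over $\mathbb{K}$. Then: (1) If $K$ is perfect, then $C(K,X)$ has the Daugavet property. (2) If $K$ is not perfect, then $C(K,X)$ has the super alternative Daugavet property if and only if either $X$ is an infinite-dimensional space with the super alternative Daugavet property, or $K$ is a singleton and $X=\mathbb{K}$ (i.e. $C(K,X)\equiv\mathbb{K}$).
   Context: Banach spaces are non-zero and over $\mathbb{K}$ ($\mathbb{R}$ or $\mathbb{C}$), compact spaces are non-empty; $B_X$, $S_X$ denote the closed unit ball and the unit sphere of $X$; $\mathbb{T}=\{\theta\in\mathbb{K}:|\theta|=1\}$. $C(K,X)$ is the space of continuous functions from $K$ to $X$ with the supremum norm. $K$ is perfect if it has no isolated points. The equality $X=\mathbb{K}$ is understood up to isometric isomorphism. A Banach space $X$ has the Daugavet property if $\|\mathrm{Id}+T\|=1+\|T\|$ for every bounded rank-one operator $T\colon X\to X$. It has the super alternative Daugavet property if for every $x\in S_X$ and every non-empty relatively weakly open subset $W$ of $B_X$ with $W\cap S_X\neq\emptyset$, one has $\sup_{y\in W}\max_{\theta\in\mathbb{T}}\|x+\theta y\|=2$. *)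

(* Defs.v *)
From HB Require Import structures.
From mathcomp Require Import all_boot all_order all_algebra.
From mathcomp Require Import all_classical all_reals all_analysis.
From mathcomp Require Import ring.
From mathcomp Require Import complex.

Set Implicit Arguments.
Unset Strict Implicit.
Unset Printing Implicit Defensive.

Import Order.TTheory GRing.Theory Num.Theory.
Import numFieldNormedType.Exports.

Local Open Scope classical_set_scope.
Local Open Scope ring_scope.

Variant scalar_kind := RealScalars | ComplexScalars.

Definition scalar_field (R : realType) (s : scalar_kind) : numFieldType :=
  match s with
  | RealScalars => R
  | ComplexScalars => R[i]
  end.

(* Norms take their values in the scalar field F itself. When F = R[i], the
   order on F is the partial order for which a <= b iff b - a is a nonnegative
   real, so a nonempty bounded set of norms still has its usual supremum. *)
Definition sup_norm (F : numFieldType) (T : Type) (V : normedModType F)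
    (A : set T) (f : T -> V) : F :=
  supremum 0 [set `|f t| | t in A].

(* The compactness proof is a parameter of the type because the supremum norm
   is a norm only on the continuous functions that are bounded. *)
Definition contfun (K : topologicalType) (hK : compact [set: K])
    (F : numFieldType) (X : normedModType F) : Type :=
  continuousType K X.

Section contfun_lmodule.
Context (K : topologicalType) (hK : compact [set: K]).
Context (F : numFieldType) (X : normedModType F).
Local Notation C := (contfun hK X).

HB.instance Definition _ := Choice.copy C (continuousType K X).

Lemma contfunP (f g : C) : (f : K -> X) =1 g -> f = g.
Proof. by move/continuousEP. Qed.

Lemma contfun_continuous (f : C) : continuous (f : K -> X).
Proof. exact: cts_fun. Qed.

Lemma contfun0_subproof : continuous (fun _ : K => 0 : X).
Proof. by move=> x; exact: cvg_cst. Qed.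

Lemma contfunN_subproof (f : C) : continuous (fun x : K => - f x).
Proof. by move=> x; apply: cvgN; exact: contfun_continuous. Qed.

Lemma contfunD_subproof (f g : C) : continuous (fun x : K => f x + g x).
Proof. by move=> x; apply: cvgD; exact: contfun_continuous. Qed.

Lemma contfunZ_subproof (a : F) (f : C) : continuous (fun x : K => a *: f x).
Proof. by move=> x; apply: cvgZl_tmp; exact: contfun_continuous. Qed.

Definition mkcontfun (f : K -> X) (cf : continuous f) : C := mkcts cf.

Definition contfun0 : C := mkcontfun contfun0_subproof.
Definition contfunN (f : C) : C := mkcontfun (@contfunN_subproof f).
Definition contfunD (f g : C) : C :=
  mkcontfun (@contfunD_subproof f g).
Definition contfunZ (a : F) (f : C) : C :=
  mkcontfun (@contfunZ_subproof a f).

Lemma contfunDA : associative contfunD.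
Proof. by move=> f g h; apply: contfunP => x /=; exact: addrA. Qed.
Lemma contfunDC : commutative contfunD.
Proof. by move=> f g; apply: contfunP => x /=; exact: addrC. Qed.
Lemma contfun0D : left_id contfun0 contfunD.
Proof. by move=> f; apply: contfunP => x /=; exact: add0r. Qed.
Lemma contfunND : left_inverse contfun0 contfunN contfunD.
Proof. by move=> f; apply: contfunP => x /=; exact: addNr. Qed.

HB.instance Definition _ :=
  GRing.isZmodule.Build C contfunDA contfunDC contfun0D contfunND.

Lemma contfunZA a b (f : C) : contfunZ a (contfunZ b f) = contfunZ (a * b) f.
Proof. by apply: contfunP => x /=; exact: scalerA. Qed.
Lemma contfun1Z : left_id 1 contfunZ.
Proof. by move=> f; apply: contfunP => x /=; exact: scale1r. Qed.
Lemma contfunZDr : right_distributive contfunZ +%R.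
Proof. by move=> a f g; apply: contfunP => x /=; exact: scalerDr. Qed.
Lemma contfunZDl (f : C) : {morph contfunZ^~ f : a b / a + b}.
Proof. by move=> a b; apply: contfunP => x /=; exact: scalerDl. Qed.

HB.instance Definition _ :=
  GRing.Zmodule_isLmodule.Build F C contfunZA contfun1Z contfunZDr contfunZDl.

Lemma contfun0E x : (0 : C) x = 0. Proof. by []. Qed.
Lemma contfunNE (f : C) x : (- f) x = - f x. Proof. by []. Qed.
Lemma contfunDE (f g : C) x : (f + g) x = f x + g x. Proof. by []. Qed.
Lemma contfunZE a (f : C) x : (a *: f) x = a *: f x. Proof. by []. Qed.

Lemma contfun_max (f : C) : [set: K] !=set0 ->
  exists k, forall x, `|f x| <= `|f k|.
Proof.
case=> k0 _; pose G := filter_from [set: K] (fun x => [set k | `|f x| <= `|f k|]).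
have GG : ProperFilter G.
  apply: filter_from_proper; last by move=> x _; exists x => /=.
  apply: filter_from_filter; first by exists k0.
  move=> x y _ _.
  have [xy|/ltW yx] := real_leP (normr_real (f x)) (normr_real (f y)).
    by exists y => // k /= yk; split => //; exact: le_trans xy yk.
  by exists x => // k /= xk; split => //; exact: le_trans yx xk.
have [|p [_ clp]] := hK (F := G); first by exists k0.
exists p => x; rewrite real_leNgt ?normr_real//; apply/negP => px.
have : nbhs p (f @^-1` ball 0 `|f x|).
  apply: contfun_continuous; apply: open_nbhs_nbhs; split; first exact: ball_open.
  by rewrite -ball_normE /= sub0r normrN.
have Gx : G [set k | `|f x| <= `|f k|] by exists x.
move=> /(clp _ _ Gx)[k [/= xk]]; rewrite -ball_normE /= sub0r normrN => kx.
by have := le_lt_trans xk kx; rewrite ltxx.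
Qed.

Definition contfun_norm (f : C) : F := sup_norm [set: K] f.

Lemma contfun_norm_attained (f : C) k :
  (forall x, `|f x| <= `|f k|) -> contfun_norm f = `|f k|.
Proof.
move=> kmax; have fk : supremums [set `|f x| | x in [set: K]] `|f k|.
  by split; [move=> _ [x _ <-]; exact: kmax|move=> M; apply; exists k].
rewrite /contfun_norm /sup_norm /supremum ifF; last first.
  by apply/negbTE/set0P; exists `|f k|, k.
by case: xgetP => [M _ /is_subset1_supremums/(_ fk)//|/(_ `|f k|)/(_ fk)].
Qed.

Lemma contfun_norm_ubound (f : C) x : `|f x| <= contfun_norm f.
Proof.
have [|k kmax] := contfun_max f; first by exists x.
by rewrite (contfun_norm_attained kmax).
Qed.

Lemma contfun_norm_le (f : C) M :
  0 <= M -> (forall x, `|f x| <= M) -> contfun_norm f <= M.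
Proof.
move=> M0 fM; have [K0|K0] := pselect ([set: K] !=set0).
  by have [k kmax] := contfun_max f K0; rewrite (contfun_norm_attained kmax).
rewrite /contfun_norm /sup_norm (_ : [set _ | _ in _] = set0) ?supremum0//.
by apply/seteqP; split => // y [x _ _]; apply: K0; exists x.
Qed.

Lemma contfun_norm_ge0 (f : C) : 0 <= contfun_norm f.
Proof.
have [[k _]|K0] := pselect ([set: K] !=set0).
  exact: le_trans (normr_ge0 (f k)) (contfun_norm_ubound f k).
rewrite /contfun_norm /sup_norm (_ : [set _ | _ in _] = set0) ?supremum0//.
by apply/seteqP; split => // y [x _ _]; apply: K0; exists x.
Qed.

Lemma contfun_normD (f g : C) :
  contfun_norm (f + g) <= contfun_norm f + contfun_norm g.
Proof.
apply: contfun_norm_le => [|x]; first by rewrite addr_ge0// contfun_norm_ge0.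
by rewrite (le_trans (ler_normD _ _))// lerD// contfun_norm_ubound.
Qed.

Lemma contfun_normZ a (f : C) :
  contfun_norm (a *: f) = `|a| * contfun_norm f.
Proof.
have leZ b (g : C) : contfun_norm (b *: g) <= `|b| * contfun_norm g.
  apply: contfun_norm_le => [|x]; first by rewrite mulr_ge0// contfun_norm_ge0.
  by rewrite contfunZE normrZ ler_wpM2l// contfun_norm_ubound.
apply: le_anti; rewrite leZ/=.
have [->|a0] := eqVneq a 0; first by rewrite normr0 mul0r contfun_norm_ge0.
rewrite -[f in leLHS](scale1r) -(mulVf a0) -scalerA.
rewrite -ler_pdivlMl ?normr_gt0// -normfV; exact: leZ.
Qed.

Lemma contfun_norm0_eq0 (f : C) : contfun_norm f = 0 -> f = 0.
Proof.
move=> f0; apply: contfunP => x; apply/normr0_eq0/le_anti.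
by rewrite normr_ge0 andbT -f0 contfun_norm_ubound.
Qed.

HB.instance Definition _ := Lmodule_isNormed.Build F C
  contfun_normD contfun_normZ contfun_norm0_eq0.

Lemma contfun_normE (f : C) : `|f| = sup_norm [set: K] f.
Proof. by []. Qed.

End contfun_lmodule.

Section contfun_complete.
Context (K : topologicalType) (hK : compact [set: K]).
Context (F : numFieldType) (X : completeNormedModType F).
Local Notation C := (contfun hK X).

Lemma contfun_complete (G : set_system C) :
  ProperFilter G -> cauchy G -> cvg G.
Proof.
move=> GG /cauchy_ballP Gc; pose ev (x : K) (f : C) : X := f x.
have evc x : cvg (ev x @ G).
  apply: cauchy_cvg; apply/cauchy_ballP => e e0; near_simpl.
  have := Gc e e0; apply: filterS => -[f g] /=.
  rewrite -!ball_normE /= => fg; apply: le_lt_trans fg.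
  exact: (contfun_norm_ubound (f - g)).
pose l x := lim (ev x @ G).
have unif e : 0 < e -> G [set f : C | forall x, `|f x - l x| < e].
  move=> e0; have e20 : 0 < e / 2 by rewrite divr_gt0.
  have /nearP_dep := Gc _ e20; apply: filterS => f nf x.
  have /cvgrPdist_lt/(_ _ e20) nl : ev x @ G --> l x := evc x.
  have [g [fg gl]] := filter_ex (filterI nf nl).
  rewrite [ltRHS]splitr -(subrK (g x) (f x)) -addrA.
  apply: le_lt_trans (ler_normD _ _) _; apply: ltrD; last by rewrite distrC.
  move: fg; rewrite -ball_normE /=; apply: le_lt_trans.
  exact: (contfun_norm_ubound (f - g)).
have lc : continuous l.
  move=> x; apply/cvgrPdist_lt => e e0.
  have e30 : 0 < e / 3 by rewrite divr_gt0.
  have [f fl] := filter_ex (unif _ e30).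
  have /cvgrPdist_lt/(_ _ e30) := @contfun_continuous _ hK _ _ f x.
  apply: filterS => y fxy.
  rewrite (_ : l x - l y = - (f x - l x) + (f x - f y) + (f y - l y)).
    rewrite (_ : e = e / 3 + e / 3 + e / 3); last by field.
    apply: le_lt_trans (ler_normD _ _) _; apply: ltrD => //.
    apply: le_lt_trans (ler_normD _ _) _; apply: ltrD => //.
    by rewrite normrN.
  by rewrite opprB !addrA !subrK.
apply/cvg_ex; exists (mkcontfun hK lc : C).
apply/cvgrPdist_le => e e0; have := unif e e0; apply: filterS => f fl.
apply: contfun_norm_le; first exact: ltW.
by move=> x; rewrite contfunDE contfunNE distrC ltW// fl.
Qed.

HB.instance Definition _ := Uniform_isComplete.Build C contfun_complete.

End contfun_complete.

Section banach_notions.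
Context (F : numFieldType).
Implicit Types X Y : completeNormedModType F.

Definition unit_ball X : set X := [set x | `|x| <= 1].
Definition unit_sphere X : set X := [set x | `|x| = 1].
Arguments unit_ball : clear implicits.
Arguments unit_sphere : clear implicits.

Definition op_norm X Y (T : X -> Y) : F := sup_norm (unit_ball X) T.

Definition rank_one X Y (T : X -> Y) : Prop :=
  exists2 e : Y, e != 0 & range T = [set a *: e | a in [set: F]].

Definition daugavet_property X : Prop :=
  forall T : {linear X -> X}, continuous T -> rank_one T ->
    op_norm (idfun \+ T) = 1 + op_norm T.

Definition dual X : Type := {f : {linear X -> F^o} | continuous f}.

(* The coarsest topology making every continuous linear functional continuous. *)
Definition weak_topology X : Type :=
  sup_topology (fun f : dual X =>
    Topological.class (initial_topology (sval f : X -> F^o))).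
HB.instance Definition _ X := Topological.on (weak_topology X).

Definition rel_weakly_open X (A W : set X) : Prop :=
  exists2 U : set (weak_topology X), open U & W = A `&` U.

(* The inner supremum over theta is a maximum: for the scalar fields R and R[i]
   the set of theta of modulus 1 is compact. *)
Definition super_alternative_daugavet_property X : Prop :=
  forall x : X, unit_sphere X x ->
  forall W : set X, W !=set0 -> rel_weakly_open (unit_ball X) W ->
    W `&` unit_sphere X !=set0 ->
    supremum 0 [set sup_norm [set theta : F | `|theta| = 1]
                      (fun theta => x + theta *: y) | y in W] = 2.

Definition finite_dimensional X : Prop :=
  exists n (e : 'I_n -> X), forall x, exists c : 'I_n -> F,
    x = \sum_(i < n) c i *: e i.

Definition isometrically_isomorphic (X Y : normedModType F) : Prop :=
  exists2 f : {linear X -> Y}, bijective f & forall x, `|f x| = `|x|.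

End banach_notions.

(* Main.v *)
(** Both parts rest on one perturbation lemma: if [k] is not isolated in [K], then
    near any [f] in the unit ball of C(K, X), in the weak topology, there is a
    [g] in the unit ball taking a prescribed value [v] of norm at most 1 at some
    point close to [k].  One replaces [f] by [v] inside a small open set; since
    infinitely many disjoint such sets are available near [k], a bounded
    functional cannot see all of these modifications.  For a rank-one operator
    [T] and a function [f] almost norming it, choosing [k] where [T f] attains
    its norm and [v] in the direction of [T f k] gives the Daugavet equation.

    The alternative property is used through basic weak neighbourhoods.  Let
    [x] be a unit vector of C(K, X) attaining its norm at [k].  If [k] is not
    isolated, the perturbation lemma applies; if it is, only the coordinate at
    [k] has to be moved, and when [X] is infinite-dimensional that coordinate may
    first be pushed to the unit sphere along a common kernel of the functionals.
    Conversely, at an isolated point the property passes to [X].  If [X] has finite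
    dimension, weak neighbourhoods contain norm neighbourhoods: a second point of
    [K] then gives disjointly supported [f], [g] with [f + theta g] of norm 1, and
    on [X] one gets [max_theta |x + theta y| = 2] for all unit [x], [y].  The latter
    forces dimension one: at a point where the norm is largest relative to a
    Euclidean norm on a plane, Euclidean-orthogonal directions increase the norm
    only to second order. *)
From HB Require Import structures.
Require Import Defs.
From mathcomp Require Import all_boot all_order all_algebra.
From mathcomp Require Import all_classical all_reals all_analysis.
From mathcomp Require Import ring lra complex.

Set Implicit Arguments.
Unset Strict Implicit.
Unset Printing Implicit Defensive.

Import Order.TTheory GRing.Theory Num.Theory.
Import numFieldNormedType.Exports.

Local Open Scope classical_set_scope.
Local Open Scope ring_scope.

(** * Real-valued norms over both scalar fields *)

Section scalars.
Context (R : realType) (s : scalar_kind).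
Local Notation F := (scalar_field R s).

Definition of_real : R -> F :=
  match s return R -> scalar_field R s with
  | RealScalars => fun x => x
  | ComplexScalars => fun x => x%:C%C
  end.

Definition re : F -> R :=
  match s return scalar_field R s -> R with
  | RealScalars => fun x => x
  | ComplexScalars => fun x => complex.Re x
  end.

Lemma of_realK : cancel of_real re.
Proof. by rewrite /of_real /re; case: s. Qed.

Lemma ge0_reK x : 0 <= x -> of_real (re x) = x.
Proof.
rewrite /of_real /re; case: s x => //= x x0.
by apply: RRe_real; apply: ger0_real.
Qed.

Lemma ler_of_real a b : (of_real a <= of_real b) = (a <= b).
Proof. by rewrite /of_real; case: s => //=; rewrite lecR. Qed.

Lemma ltr_of_real a b : (of_real a < of_real b) = (a < b).
Proof. by rewrite /of_real; case: s => //=; rewrite ltcR. Qed.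

Lemma of_real_is_zmod_morphism : zmod_morphism of_real.
Proof. by rewrite /of_real; case: s => //= x y; rewrite rmorphB. Qed.

Lemma of_real_is_monoid_morphism : monoid_morphism of_real.
Proof.
by rewrite /of_real; case: s => //=; split=> // x y; rewrite rmorphM.
Qed.

HB.instance Definition _ :=
  GRing.isZmodMorphism.Build R F of_real of_real_is_zmod_morphism.
HB.instance Definition _ :=
  GRing.isMonoidMorphism.Build R F of_real of_real_is_monoid_morphism.

Lemma norm_of_real a : `|of_real a| = of_real `|a|.
Proof.
rewrite /of_real; case: s => //=; rewrite normc_def /= expr0n addr0.
by rewrite sqrtr_sqr.
Qed.

(** The limit is the supremum of the lower estimates [f a - e]: the Cauchy condition makes every
    [f b + e] an upper bound of them. Indexing by tolerances avoids choosing a sequence. *)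
Lemma approximate_values_limit (T : Type) (f : T -> R) (A : R -> set T) :
  (forall e, 0 < e -> A e !=set0) ->
  (forall e e' a b, 0 < e -> 0 < e' -> A e a -> A e' b ->
    `|f a - f b| <= e + e') ->
  exists l, forall e a, 0 < e -> A e a -> `|f a - l| <= e.
Proof.
move=> A0 Acauchy.
pose S := [set f ea.2 - ea.1 | ea in [set ea : R * T | 0 < ea.1 /\ A ea.1 ea.2]].
have Sub e b : 0 < e -> A e b -> ubound S (f b + e).
  move=> e0 Ab _ [[e' a] /= [e'0 Aa] <-].
  have := Acauchy _ _ _ _ e'0 e0 Aa Ab.
  by rewrite ler_norml => /andP[? ?]; lra.
have S0 : S !=set0.
  by have [a Aa] := A0 1 ltr01; exists (f a - 1), (1, a).
exists (sup S) => e a e0 Aa.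
have ? : sup S <= f a + e by apply: ge_sup => //; exact: Sub.
have ? : f a - e <= sup S.
  by apply: ub_le_sup; [exists (f a + e); apply: Sub|exists (e, a)].
by rewrite ler_norml; apply/andP; split; lra.
Qed.

(* The factor 2 comes from treating real and imaginary parts separately. *)
Lemma scalar_complete (A : R -> set F) :
  (forall e, 0 < e -> A e !=set0) ->
  (forall e e' a b, 0 < e -> 0 < e' -> A e a -> A e' b ->
    re `|a - b| <= e + e') ->
  exists l, forall e a, 0 < e -> A e a -> re `|a - l| <= 2 * e.
Proof.
rewrite /re; move: A; case: s => /= A A0 Acauchy.
  have [l lP] := approximate_values_limit (f := id) A0 Acauchy.
  by exists l => e a e0 Aa; rewrite (le_trans (lP e a e0 Aa))//; lra.
have normRe (x : R[i]) : `|complex.Re x| <= complex.Re `|x|.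
  by rewrite normc_def /= -sqrtr_sqr ler_wsqrtr// lerDl sqr_ge0.
have normIm (x : R[i]) : `|complex.Im x| <= complex.Re `|x|.
  by rewrite normc_def /= -sqrtr_sqr ler_wsqrtr// lerDr sqr_ge0.
have normReIm (x : R[i]) : complex.Re `|x| <= `|complex.Re x| + `|complex.Im x|.
  rewrite normc_def /= -[leRHS]ger0_norm ?addr_ge0// -sqrtr_sqr.
  rewrite ler_wsqrtr// sqrrD !real_normK ?num_real//.
  by rewrite addrAC lerDl mulrn_wge0// mulr_ge0.
have [|p Hp] := approximate_values_limit (f := @complex.Re R) A0.
  move=> e e' a b e0 e'0 Aa Ab; apply: le_trans (Acauchy _ _ _ _ e0 e'0 Aa Ab).
  by apply: le_trans (normRe _); case: (a) (b) => ? ? [? ?].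
have [|q Hq] := approximate_values_limit (f := @complex.Im R) A0.
  move=> e e' a b e0 e'0 Aa Ab; apply: le_trans (Acauchy _ _ _ _ e0 e'0 Aa Ab).
  by apply: le_trans (normIm _); case: (a) (b) => ? ? [? ?].
exists (Complex p q) => e a e0 Aa.
apply: le_trans (normReIm _) _; rewrite mulr2n mulrDl mul1r.
have := Hp _ _ e0 Aa; have := Hq _ _ e0 Aa.
by case: a {Aa} => x y /= qe pe; rewrite lerD.
Qed.

(* (c, d) is (- conjc b, conjc a), which is orthogonal to (a, b). *)
Lemma scalar_orthogonal (a b : F) : exists c d : F,
  `|c| ^+ 2 + `|d| ^+ 2 = `|a| ^+ 2 + `|b| ^+ 2 /\
  forall t : F, `|a + t * c| ^+ 2 + `|b + t * d| ^+ 2 =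
    (1 + `|t| ^+ 2) * (`|a| ^+ 2 + `|b| ^+ 2).
Proof.
move: a b; case: s => /= a b.
  exists (- b), a; rewrite !real_normK ?num_real//; split; first by ring.
  by move=> t; rewrite !real_normK ?num_real//; ring.
exists (- conjc b), (conjc a).
have nE (x : R[i]) : `|x| ^+ 2 = x * conjc x.
  rewrite -add_Re2_Im2; case: x => x y /=; apply/eqP.
  by rewrite eq_complex /=; apply/andP; split; apply/eqP; ring.
split; first by rewrite !nE rmorphN /= !conjcK; ring.
move=> t; rewrite !nE !rmorphD !rmorphM rmorphN /= !conjcK; ring.
Qed.

Lemma supremumE (A : set F) (m : R) :
  (forall x, A x -> x <= of_real m) ->
  (forall e, 0 < e -> exists2 x, A x & of_real (m - e) <= x) ->
  supremum 0 A = of_real m.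
Proof.
move=> Aub Aap.
have Am : supremums A (of_real m).
  split=> // M Mub.
  (* The order on [F] may be partial, but [M] dominates the real number [m - 1], so [M] is itself
     real and comparable with [m]. *)
  have [x Ax mx] := Aap 1 ltr01.
  have M0 : M - of_real (m - 1) >= 0 by rewrite subr_ge0 (le_trans mx)// Mub.
  have [c Mc] : exists c, M = of_real c.
    exists (re (M - of_real (m - 1)) + (m - 1)).
    by rewrite rmorphD /= ge0_reK// subrK.
  rewrite Mc ler_of_real in Mub *; apply/ler_addgt0Pr => e e0.
  have [y Ay me] := Aap _ e0.
  by move: (le_trans me (Mub _ Ay)); rewrite ler_of_real; lra.
rewrite /supremum ifF; last first.
  by apply/negbTE/set0P; have [x Ax _] := Aap 1 ltr01; exists x.
by case: xgetP => [M _ /is_subset1_supremums/(_ Am)//|/(_ (of_real m))/(_ Am)].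
Qed.

Lemma supremum_approx (A : set F) (M : R) :
  A !=set0 -> (forall x, A x -> 0 <= x /\ x <= of_real M) ->
  exists m : R, [/\ supremum 0 A = of_real m,
    forall x, A x -> x <= of_real m &
    forall e, 0 < e -> exists2 x, A x & of_real (m - e) <= x].
Proof.
move=> A0 AM; pose B := [set re x | x in A].
have BE x : A x -> of_real (re x) = x by case/AM => /ge0_reK.
have Bsup : has_sup B.
  split; first by case: A0 => x; exists (re x), x.
  exists M => _ [x Ax <-].
  by rewrite -ler_of_real BE//; case: (AM _ Ax).
have ub x : A x -> x <= of_real (sup B).
  move=> Ax; rewrite -(BE _ Ax) ler_of_real.
  by apply: ub_le_sup; [case: Bsup|exists x].
have ap e : 0 < e -> exists2 x, A x & of_real (sup B - e) <= x.
  move=> e0; have [_ [x Ax <-] ex] := sup_adherent e0 Bsup.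
  by exists x => //; rewrite -(BE _ Ax) ler_of_real ltW.
by exists (sup B); split => //; exact: supremumE.
Qed.

End scalars.

(** Norms live in [F], whose order is partial for complex scalars; their real values give total
    comparisons and linear arithmetic. *)
Definition nrm (R : realType) (s : scalar_kind)
  (V : normedZmodType (scalar_field R s)) (x : V) : R := re `|x|.

Section norms.
Context (R : realType) (s : scalar_kind).
Local Notation F := (scalar_field R s).
Local Notation nrmF := (@nrm R s F).

Lemma nrmE (V : normedZmodType F) (x : V) : of_real s (nrm x) = `|x|.
Proof. exact: ge0_reK. Qed.

Lemma nrm_ge0 (V : normedZmodType F) (x : V) : 0 <= nrm x.
Proof. by rewrite -(ler_of_real s) nrmE rmorph0. Qed.

Lemma norm_le_of_real (V : normedZmodType F) (x : V) r :
  (`|x| <= of_real s r) = (nrm x <= r).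
Proof. by rewrite -nrmE ler_of_real. Qed.

Lemma norm_lt_of_real (V : normedZmodType F) (x : V) r :
  (`|x| < of_real s r) = (nrm x < r).
Proof. by rewrite -nrmE ltr_of_real. Qed.

Lemma ler_nrm (V W : normedZmodType F) (x : V) (y : W) :
  (nrm x <= nrm y) = (`|x| <= `|y|).
Proof. by rewrite -norm_le_of_real nrmE. Qed.

Lemma norm_eq_of_real (V : normedZmodType F) (x : V) r :
  `|x| = of_real s r -> nrm x = r.
Proof. by rewrite /nrm => ->; exact: of_realK. Qed.

Lemma norm_eq1 (V : normedZmodType F) (x : V) : `|x| = 1 <-> nrm x = 1.
Proof.
split=> [x1|x1]; first by apply: norm_eq_of_real; rewrite rmorph1.
by rewrite -nrmE x1 rmorph1.
Qed.

Lemma norm_le1 (V : normedZmodType F) (x : V) : (`|x| <= 1) = (nrm x <= 1).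
Proof. by rewrite -norm_le_of_real rmorph1. Qed.

Lemma nrm0 (V : normedZmodType F) : nrm (0 : V) = 0.
Proof. by apply: norm_eq_of_real; rewrite normr0 rmorph0. Qed.

Lemma nrm_eq0 (V : normedZmodType F) (x : V) : nrm x = 0 -> x = 0.
Proof. by move=> x0; apply: normr0_eq0; rewrite -nrmE x0 rmorph0. Qed.

Lemma nrm_gt0 (V : normedZmodType F) (x : V) : x != 0 -> 0 < nrm x.
Proof.
by move=> x0; rewrite lt_neqAle nrm_ge0 andbT eq_sym; apply: contra_neq x0 => /nrm_eq0.
Qed.

Lemma nrmN (V : normedZmodType F) (x : V) : nrm (- x) = nrm x.
Proof. by rewrite /nrm normrN. Qed.

Lemma ler_nrmD (V : normedZmodType F) (x y : V) : nrm (x + y) <= nrm x + nrm y.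
Proof. by rewrite -norm_le_of_real rmorphD/= !nrmE ler_normD. Qed.

Lemma ler_nrm_sum (V : normedZmodType F) (I : Type) (r : seq I) (f : I -> V) :
  nrm (\sum_(i <- r) f i) <= \sum_(i <- r) nrm (f i).
Proof.
elim: r => [|i r ih]; first by rewrite !big_nil nrm0.
by rewrite !big_cons (le_trans (ler_nrmD _ _))// lerD2l.
Qed.

Lemma nrm1 : nrmF 1 = 1.
Proof. by apply/norm_eq1; rewrite normr1. Qed.

Lemma nrm_of_real r : nrmF (of_real s r) = `|r|.
Proof. by apply: norm_eq_of_real; exact: norm_of_real. Qed.

Lemma nrmM (a b : F) : nrmF (a * b) = nrmF a * nrmF b.
Proof. by apply: norm_eq_of_real; rewrite rmorphM/= !nrmE normrM. Qed.

Lemma nrmV (a : F) : nrmF a^-1 = (nrmF a)^-1.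
Proof. by apply: norm_eq_of_real; rewrite fmorphV/= !nrmE normfV. Qed.

Lemma nrmZ (V : normedModType F) (a : F) (x : V) : nrm (a *: x) = nrmF a * nrm x.
Proof. by apply: norm_eq_of_real; rewrite rmorphM/= !nrmE normrZ. Qed.

Lemma nrmZ_real (V : normedModType F) r (x : V) :
  nrm (of_real s r *: x) = `|r| * nrm x.
Proof. by rewrite nrmZ nrm_of_real. Qed.

Lemma nrm_phase (a : F) : exists2 t : F, nrmF t = 1 & t * a = of_real s (nrmF a).
Proof.
have [->|a0] := eqVneq a 0.
  by exists 1; rewrite ?nrm1// mulr0 nrm0 rmorph0.
exists (of_real s (nrm a) / a); last by rewrite divfK.
rewrite nrmM nrmV nrm_of_real ger0_norm ?nrm_ge0// divff//.
by rewrite gt_eqF// nrm_gt0.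
Qed.

(* [v] is arbitrary of norm 1 when [x = 0]. *)
Lemma unit_direction (V : normedModType F) (x : V) :
  (exists y : V, y != 0) -> exists2 v, nrm v = 1 & x = of_real s (nrm x) *: v.
Proof.
have nv (y : V) : y != 0 -> nrm (of_real s (nrm y)^-1 *: y) = 1.
  move=> y0; rewrite nrmZ_real ger0_norm ?invr_ge0 ?nrm_ge0// mulVf//.
  by rewrite gt_eqF// nrm_gt0.
have [->|x0 _] := eqVneq x 0.
  case=> y y0; exists (of_real s (nrm y)^-1 *: y); first exact: nv.
  by rewrite nrm0 rmorph0 scale0r.
exists (of_real s (nrm x)^-1 *: x); first exact: nv.
by rewrite scalerA -rmorphM/= mulfV ?rmorph1 ?scale1r// gt_eqF// nrm_gt0.
Qed.

End norms.

(** * Functionals and weak neighbourhoods *)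

Section functionals.
Context (R : realType) (s : scalar_kind).
Local Notation F := (scalar_field R s).
Local Notation nrmF := (@nrm R s F).

Lemma linear_bound (V W : normedModType F) (f : {linear V -> W}) :
  continuous f -> exists2 C, 0 < C & forall x, nrm (f x) <= C * nrm x.
Proof.
move=> /linear_bounded_continuous/linear_boundedP/pinfty_ex_gt0[r r0 fr].
have rE : r = of_real s (re r) by rewrite ge0_reK// ltW.
exists (re r) => [|x]; first by rewrite -(ltr_of_real s) -rE rmorph0.
by rewrite -norm_le_of_real rmorphM/= -rE nrmE.
Qed.

Lemma bounded_linear_cont (V W : normedModType F) (f : {linear V -> W}) C :
  (forall x, nrm (f x) <= C * nrm x) -> continuous f.
Proof.
move=> fC; apply: bounded_linear_continuous; apply/linear_boundedP.
near=> r => x; rewrite -!nrmE (_ : r = of_real s (re r)); last first.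
  by rewrite ge0_reK//; near: r; apply: nbhs_pinfty_ge; rewrite real0.
rewrite -rmorphM/= ler_of_real (le_trans (fC x))// ler_wpM2r ?nrm_ge0//.
rewrite -(ler_of_real s) ge0_reK; last first.
  by near: r; apply: nbhs_pinfty_ge; rewrite real0.
near: r; apply: nbhs_pinfty_ge.
by rewrite realE -(rmorph0 (of_real s)) !ler_of_real le_total.
Unshelve. all: by end_near. Qed.

Lemma linear_of (V W : lmodType F) (f : V -> W) :
  (forall a x y, f (a *: x + y) = a *: f x + f y) ->
  exists g : {linear V -> W}, (g : V -> W) = f.
Proof.
move=> fl; pose m := GRing.isLinear.Build F V W *:%R f fl.
by pose g : {linear V -> W} := HB.pack f m; exists g.
Qed.

Lemma dual_of (X : completeNormedModType F) (f : X -> F) C :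
  (forall a x y, f (a *: x + y) = a * f x + f y) ->
  (forall x, nrmF (f x) <= C * nrm x) ->
  exists phi : dual X, forall x, sval phi x = f x.
Proof.
move=> fl fC; have [g gE] := @linear_of X F^o f fl.
have gc : continuous g by apply: (@bounded_linear_cont _ _ _ C) => x; rewrite gE.
by exists (exist _ g gc) => x /=; rewrite gE.
Qed.

Lemma dual_bound (X : completeNormedModType F) (phi : dual X) :
  exists2 C, 0 < C & forall x, nrmF (sval phi x) <= C * nrm x.
Proof. by case: phi => f fc; exact: (linear_bound fc). Qed.

Definition weak_nbhs (X : completeNormedModType F) (x : X) : set_system X :=
  [set U | exists (phis : seq (dual X)) (d : R), 0 < d /\ forall y,
    (forall phi, List.In phi phis -> nrmF (sval phi (y - x)) < d) -> U y].

Lemma weak_nbhs_filter (X : completeNormedModType F) (x : X) :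
  Filter (weak_nbhs x).
Proof.
constructor.
- by exists [::], 1.
- move=> U V [p [d [d0 Ud]]] [q [e [e0 Ve]]].
  exists (p ++ q), (Num.min d e); rewrite lt_min d0 e0; split => // y pq; split.
    apply: Ud => phi phip; have := pq phi.
    by rewrite lt_min List.in_app_iff => /(_ (or_introl phip))/andP[].
  apply: Ve => phi phip; have := pq phi.
  by rewrite lt_min List.in_app_iff => /(_ (or_intror phip))/andP[].
- by move=> U V UV [p [d [d0 Ud]]]; exists p, d; split => // y /Ud/UV.
Qed.

Lemma nbhs_weak_nbhs (X : completeNormedModType F) (x : X) (U : set X) :
  nbhs (x : weak_topology X) U -> weak_nbhs x U.
Proof.
move: U; have Wf := weak_nbhs_filter x.
(* The weak topology is a supremum of initial topologies, so convergence of the filter [weak_nbhs x]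
   can be tested one functional at a time. *)
apply/(@cvg_sup X _ _ (weak_nbhs x) x) => phi U.
rewrite nbhsE/= => -[V [[B Bo <-] Bx] BU].
have /nbhs_ballP[e /= e0 eB] : nbhs (sval phi x) B by apply: open_nbhs_nbhs.
exists [:: phi], (re e).
have eE : e = of_real s (re e) by rewrite ge0_reK// ltW.
split=> [|y yphi]; first by rewrite -(ltr_of_real s) -eE rmorph0.
apply/BU/eB; rewrite -ball_normE /= distrC eE norm_lt_of_real.
by rewrite -linearB; apply: yphi; left.
Qed.

Lemma weak_ball_open (X : completeNormedModType F) (x : X)
    (phis : seq (dual X)) (d : R) : 0 < d ->
  open ([set y | forall phi, List.In phi phis -> nrmF (sval phi (y - x)) < d]
    : set (weak_topology X)).
Proof.
move=> d0; elim: phis => [|phi phis ih].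
  have -> : [set y : X | forall phi : dual X, List.In phi [::] ->
      nrmF (sval phi (y - x)) < d] = [set: X] by apply/seteqP; split=> // y _ phi [].
  exact: (@openT (weak_topology X)).
have -> : [set y : X | forall psi : dual X, List.In psi (phi :: phis) ->
    nrmF (sval psi (y - x)) < d] = [set y | nrmF (sval phi (y - x)) < d] `&`
    [set y | forall psi, List.In psi phis -> nrmF (sval psi (y - x)) < d].
  apply/seteqP; split => [y yd /=|y [yd yds] psi /= [<-//|]].
    by split=> [|psi psis]; apply: yd; [left|right].
  exact: yds.
apply: (@openI (weak_topology X)) ih; rewrite openE => y /= yd.
  have := (@cvg_sup X _ (fun f : dual X =>
    Topological.class (initial_topology (sval f : X -> F^o)))
    (nbhs (y : weak_topology X)) y _).1 (@cvg_id _ _) phi; apply.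
  apply: open_nbhs_nbhs; split=> //.
  exists (ball (sval phi x) (of_real s d)); first exact: ball_open.
  apply/seteqP; split => z /=;
  by rewrite -ball_normE/= distrC -linearB norm_lt_of_real.
Qed.

Lemma sup_norm_rotations (V : normedModType F) (x y : V) :
  nrm x <= 1 -> nrm y <= 1 ->
  exists m, [/\ sup_norm [set theta : F | `|theta| = 1]
      (fun theta => x + theta *: y) = of_real s m, m <= 2,
    forall t, nrmF t = 1 -> nrm (x + t *: y) <= m &
    forall e, 0 < e -> exists2 t, nrmF t = 1 & m - e <= nrm (x + t *: y)].
Proof.
move=> x1 y1; have xy2 t : nrmF t = 1 -> nrm (x + t *: y) <= 2.
  by move=> t1; rewrite (le_trans (ler_nrmD _ _))// nrmZ t1; lra.
have [||m [mE mub map]] := @supremum_approx R s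
    [set `|x + t *: y| | t in [set t : F | `|t| = 1]] 2.
- by exists `|x + 1 *: y|; exists 1 => //=; rewrite normr1.
- move=> _ [t /= /norm_eq1 t1 <-]; split=> //.
  by rewrite norm_le_of_real xy2.
have mup t : nrmF t = 1 -> nrm (x + t *: y) <= m.
  by move=> t1; rewrite -norm_le_of_real; apply: mub; exists t => //; apply/norm_eq1.
have mapp e : 0 < e -> exists2 t, nrmF t = 1 & m - e <= nrm (x + t *: y).
  move=> /map[_ [t /= /norm_eq1 t1 <-]]; rewrite -nrmE ler_of_real => em.
  by exists t.
exists m; split => //; apply/ler_addgt0Pr => e /mapp[t /xy2]; lra.
Qed.

(** Within the ball, a relatively weakly open set contains a basic neighbourhood of each of its unit
    points; conversely such a neighbourhood is itself relatively weakly open. The nested suprema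
    turn into a single tolerance [e]. *)
Lemma super_alternative_daugavetP (X : completeNormedModType F) :
  super_alternative_daugavet_property X <->
  forall x y0 : X, nrm x = 1 -> nrm y0 = 1 ->
  forall (phis : seq (dual X)) (d e : R), 0 < d -> 0 < e ->
  exists y t, [/\ nrm y <= 1, nrmF t = 1,
    forall phi, List.In phi phis -> nrmF (sval phi (y - y0)) < d &
    2 - e <= nrm (x + t *: y)].
Proof.
split=> [sad x y0 x1 y01 phis d e d0 e0|sad x].
  pose W := @unit_ball F X `&` [set y : X | forall phi, List.In phi phis ->
    nrmF (sval phi (y - y0)) < d].
  have Wy0 : W y0.
    split=> [|phi _]; first by rewrite /unit_ball/= norm_le1 y01.
    by rewrite subrr linear0 nrm0.
  have sup2 : supremum 0 [set sup_norm [set theta : F | `|theta| = 1]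
      (fun theta => x + theta *: y) | y in W] = 2.
    apply: sad => //; first by apply/norm_eq1.
    - by exists y0.
    - by eexists; [exact: (weak_ball_open y0 phis d0)|].
    - by exists y0; split=> //; apply/norm_eq1.
  have Wball y : W y -> nrm y <= 1 by case; rewrite /unit_ball/= norm_le1.
  have [||m [mE _ map]] := @supremum_approx R s
    [set sup_norm [set theta : F | `|theta| = 1]
      (fun theta => x + theta *: y) | y in W] 2.
  - by eexists; exists y0.
  - move=> _ [y /Wball y1 <-].
    have [|//|m [-> m2 mub _]] := @sup_norm_rotations _ x y; first by rewrite x1.
    rewrite -(rmorph0 (of_real s)) !ler_of_real; split=> //.
    by apply: le_trans (nrm_ge0 _) (mub 1 (nrm1 _ _)).
  have m2 : m = 2.
    by apply: (can_inj (of_realK s)); rewrite -mE sup2 rmorphMn rmorph1.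
  have [|_ [y Wy <-]] := map (e / 2); first by lra.
  have [|//|M [-> _ _ Map]] := @sup_norm_rotations _ x y; rewrite ?x1 ?Wball//.
  rewrite ler_of_real m2 => eM; have [|t t1 tM] := Map (e / 2); first by lra.
  exists y, t; split => //; [exact: Wball|by case: Wy|by lra].
move=> /norm_eq1 x1 W W0 [U Uo WE] [y0 [Wy0 /norm_eq1 y01]].
have Wball y : W y -> nrm y <= 1 by rewrite WE => -[+ _]; rewrite /unit_ball/= norm_le1.
rewrite (_ : 2 = of_real s 2); last by rewrite rmorphMn rmorph1.
apply: supremumE => [_ [y /Wball y1 <-]|e e0].
  have [|//|m [-> m2 _ _]] := @sup_norm_rotations _ x y; first by rewrite x1.
  by rewrite ler_of_real.
have [phis [d [d0 dU]]] : weak_nbhs y0 U.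
  apply: nbhs_weak_nbhs; apply: open_nbhs_nbhs; split => //.
  by move: Wy0; rewrite WE => -[].
have [y [t [y1 t1 yy0 xy]]] := sad _ _ x1 y01 phis d e d0 e0.
eexists; first by exists y => //; rewrite WE; split; [rewrite /unit_ball/= norm_le1|exact: dU].
have [|//|m [-> _ mub _]] := @sup_norm_rotations _ x y; first by rewrite x1.
by rewrite ler_of_real (le_trans xy)// mub.
Qed.

End functionals.

(** * Perturbing continuous functions near a non-isolated point *)

Section contfun_facts.
Context (R : realType) (s : scalar_kind).
Local Notation F := (scalar_field R s).
Local Notation nrmF := (@nrm R s F).
Context (K : topologicalType) (hK : compact [set: K]).
Context (X : completeNormedModType F).
Local Notation C := (contfun hK X).

Lemma mkcontfunE (f : K -> X) (cf : continuous f) x : mkcontfun hK cf x = f x.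
Proof. by []. Qed.

Lemma nrm_contfun_ge (f : C) x : nrm (f x) <= nrm f.
Proof. by rewrite ler_nrm; exact: contfun_norm_ubound. Qed.

Lemma nrm_contfun_le (f : C) M :
  0 <= M -> (forall x, nrm (f x) <= M) -> nrm f <= M.
Proof.
move=> M0 fM; rewrite -norm_le_of_real; apply: contfun_norm_le.
  by rewrite -(rmorph0 (of_real s)) ler_of_real.
by move=> x; rewrite norm_le_of_real.
Qed.

Lemma nrm_contfun_attained (f : C) :
  [set: K] !=set0 -> exists k, nrm f = nrm (f k).
Proof.
move=> /(contfun_max f)[k fk]; exists k.
by rewrite /nrm {1}/Num.norm /= (contfun_norm_attained fk).
Qed.

Lemma of_real_continuous : continuous (of_real s : R -> F).
Proof.
move=> r; apply/cvgrPdist_lt => e e0.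
have eE : e = of_real s (re e) by rewrite ge0_reK// ltW.
have re0 : 0 < re e by rewrite -(ltr_of_real s) -eE rmorph0.
move: (re e) eE re0 => {e0} d -> re0.
have /cvgrPdist_lt/(_ _ re0) : id x @[x --> r] --> r by exact: cvg_id.
by apply: filterS => x; rewrite -rmorphB norm_of_real ltr_of_real.
Qed.

Lemma scaled_continuous (b : K -> R) (w : C) :
  continuous b -> continuous (fun x => of_real s (b x) *: w x).
Proof.
move=> bc x; apply: cvgZ; last exact: contfun_continuous.
exact: (cvg_comp b (of_real s) (bc x) (@of_real_continuous (b x))).
Qed.

Lemma evaluation_dual (phi : dual X) (k : K) :
  exists psi : dual C, forall f, sval psi f = sval phi (f k).
Proof.
have [c c0 phic] := dual_bound phi.
apply: (@dual_of _ _ _ (fun f : C => sval phi (f k)) c) => [a f g|f].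
  by rewrite contfunDE contfunZE linearP.
by rewrite (le_trans (phic _))// ler_pM2l// nrm_contfun_ge.
Qed.

Hypothesis hausK : hausdorff_space K.

(** Urysohn's lemma in a compact Hausdorff space, separating [t] from the complement of the interior
    of [V]. *)
Lemma bump_function (t : K) (V : set K) : nbhs t V ->
  exists b : K -> R, [/\ continuous b, forall x, 0 <= b x <= 1, b t = 1 &
    forall x, ~ V x -> b x = 0].
Proof.
move=> Vt.
have := (@normal_separatorP R K).1 (compact_normal hausK hK) (~` V^°) [set t].
move=> /(_ _ _ _)/(@uniform_separatorP _ R)[|||b [bc b01 b0 b1]].
- by apply: open_closedC; exact: open_interior.
- exact/accessible_closed_set1/hausdorff_accessible.
- by rewrite -subset0 => x [Vx /= xt]; apply: Vx; rewrite xt.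
exists b; split => //.
- by move=> x; have /= := b01 (b x) (ex_intro2 _ _ x I erefl); rewrite in_itv.
- by apply: b1; exists t.
- by move=> x Vx; apply: b0; exists x => // /interior_subset.
Qed.

(** As [k] is not isolated, [V] contains another point [t], and the two can be separated. The set
    [A] around [k] leaves room to repeat the construction. *)
Lemma punctured_nbhs_split (k : K) (V : set K) : ~ open [set k] -> nbhs k V ->
  exists (t : K) (A B : set K), [/\ nbhs k A, nbhs t B, A `<=` V, B `<=` V &
    forall x, A x -> B x -> False].
Proof.
move=> nok Vk.
have [t Vt tk] : exists2 t, V^° t & t != k.
  apply: contrapT => h; apply: nok.
  rewrite (_ : [set k] = V^°); first exact: open_interior.
  apply/seteqP; split => [_ ->//|t Vt]; apply: contrapT => tk.
  by apply: h; exists t => //; apply/eqP.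
move: hausK; rewrite open_hausdorff => /(_ _ _ tk)[[B A] /= [tB kA] [Bo Ao AB]].
exists t, (A `&` V), (B `&` V); split.
- by apply: filterI => //; apply: open_nbhs_nbhs; split => //; rewrite inE in kA.
- by apply: filterI => //; apply: open_nbhs_nbhs; split => //; rewrite inE in tB.
- by move=> x [].
- by move=> x [].
- move=> x [Ax _] [Bx _]; move/eqP: AB; rewrite -subset0 => /(_ x); apply.
  by split.
Qed.

Lemma le_sum_In (I : Type) (l : seq I) (g : I -> R) (i : I) :
  (forall j, 0 <= g j) -> List.In i l -> g i <= \sum_(j <- l) g j.
Proof.
move=> g0; elim: l => [//|j l ih] /= [->|/ih gi]; rewrite big_cons.
  by rewrite lerDl sumr_ge0.
by rewrite (le_trans gi)// lerDr.
Qed.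

(* Otherwise every bump near [k], multiplied by [v - f], is far from 0 for one
   of the functionals; adding up n such functions with disjoint supports, each
   rotated suitably, makes a bounded function on which the functionals are
   large. *)
Lemma weak_perturbation (k : K) (U : set K) (v : X) (f : C)
    (phis : seq (dual C)) (d : R) :
  ~ open [set k] -> nbhs k U -> nrm v <= 1 -> nrm f <= 1 -> 0 < d ->
  exists (g : C) t, [/\ U t, nrm g <= 1, g t = v &
    forall phi, List.In phi phis -> nrmF (sval phi (g - f)) < d].
Proof.
move=> nok Uk v1 f1 d0; apply: contrapT => nex.
have cv : continuous (fun _ : K => v) by move=> x; exact: cvg_cst.
pose w : C := mkcontfun hK cv - f.
have wE x : w x = v - f x by [].
have w2 x : nrm (w x) <= 2.
  rewrite wE (le_trans (ler_nrmD _ _))// nrmN.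
  by have := nrm_contfun_ge f x; lra.
(* The function [f + b (v - f)] is pointwise a convex combination of [f] and [v], so it stays in the
   unit ball; it equals [v] at [t], hence some functional must detect the modification. *)
have bad (b : K -> R) t (bc : continuous b) : U t -> (forall x, 0 <= b x <= 1) ->
    b t = 1 -> exists2 phi, List.In phi phis &
      d <= nrmF (sval phi (mkcontfun hK (scaled_continuous (w := w) bc))).
  move=> Ut b01 bt; apply: contrapT => nphi; apply: nex.
  exists (f + mkcontfun hK (scaled_continuous (w := w) bc)), t; split => //.
  - apply: nrm_contfun_le => // x.
    have -> : (f + mkcontfun hK (scaled_continuous (w := w) bc)) x =
        of_real s (1 - b x) *: f x + of_real s (b x) *: v.
      rewrite contfunDE mkcontfunE wE rmorphB/= rmorph1 scalerBl scale1r scalerBr.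
      by rewrite -addrA [X in _ = _ + X]addrC.
    have /andP[b0 b1] := b01 x.
    rewrite (le_trans (ler_nrmD _ _))// !nrmZ_real !ger0_norm ?subr_ge0//.
    have : nrm (f x) <= 1 by apply: le_trans f1; exact: nrm_contfun_ge.
    nra.
  - by rewrite contfunDE mkcontfunE wE bt rmorph1 scale1r addrC subrK.
  - move=> phi phiin; rewrite addrAC subrr add0r ltNge; apply/negP => dphi.
    by apply: nphi; exists phi.
(* [h phi] is a sum of [n] bumps with disjoint supports inside [V], rotated so that their values
   under [phi] add without cancellation; its norm stays at most 2. Each bump adds at least [d] to
   [r phi] for some [phi] of the list. *)
have fam n : forall V, nbhs k V -> V `<=` U ->
    exists (h : dual C -> C) (r : dual C -> R), [/\
      forall phi x, ~ V x -> h phi x = 0,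
      forall phi, nrm (h phi) <= 2,
      forall phi, 0 <= r phi /\ sval phi (h phi) = of_real s (r phi) &
      n%:R * d <= \sum_(phi <- phis) r phi].
  elim: n => [|n ih] V Vk VU.
    exists (fun=> 0), (fun=> 0); split => //.
    - by move=> phi; rewrite nrm0.
    - by move=> phi; rewrite linear0 rmorph0.
    - by rewrite mul0r big1.
  have [t [A [B [Ak Bt AV BV AB]]]] := punctured_nbhs_split nok Vk.
  have [b [bc b01 bt bB]] := bump_function Bt.
  have Bin : B t by exact: nbhs_singleton.
  have [phi0 phi0in phi0d] := bad b t bc (VU _ (BV _ Bin)) b01 bt.
  set bw : C := mkcontfun _ _ in phi0d.
  have bwE x : bw x = of_real s (b x) *: w x by [].
  have [h [r [hA h2 hr hn]]] := ih A Ak (subset_trans AV VU).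
  have /choice[th thP] (phi : dual C) : exists t, nrmF t = 1 /\
      t * sval phi bw = of_real s (nrmF (sval phi bw)).
    by have [t' ? ?] := @nrm_phase R s (sval phi bw); exists t'.
  exists (fun phi => h phi + th phi *: bw),
    (fun phi => r phi + nrmF (sval phi bw)); split.
  - move=> phi x Vx; rewrite contfunDE contfunZE bwE bB; last by move/BV.
    by rewrite hA; [rewrite rmorph0 scale0r scaler0 addr0|move/AV].
  - move=> phi; apply: nrm_contfun_le => // x.
    rewrite contfunDE contfunZE bwE.
    have [Ax|Ax] := pselect (A x).
      rewrite bB; last by move=> Bx; exact: (AB x).
      rewrite rmorph0 scale0r scaler0 addr0.
      by apply: le_trans (h2 phi); exact: nrm_contfun_ge.
    rewrite hA// add0r nrmZ (thP phi).1 mul1r nrmZ_real.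
    have /andP[b0 b1] := b01 x; rewrite ger0_norm//.
    by have := w2 x; have := nrm_ge0 (w x); nra.
  - move=> phi; have [r0 hE] := hr phi; split; first by rewrite addr_ge0// nrm_ge0.
    by rewrite linearD linearZ /= rmorphD /= hE; congr (_ + _); exact: (thP phi).2.
  - rewrite big_split /= -natr1 mulrDl mul1r lerD// (le_trans phi0d)//.
    by apply: (@le_sum_In _ _ (fun phi : dual C => nrmF (sval phi bw))) => // j; exact: nrm_ge0.
have /choice[c cP] (phi : dual C) : exists c,
    0 < c /\ forall x, nrmF (sval phi x) <= c * nrm x.
  by have [c' ? ?] := dual_bound phi; exists c'.
pose M := \sum_(phi <- phis) c phi * 2.
have M0 : 0 <= M / d.
  rewrite divr_ge0 ?(ltW d0)// sumr_ge0// => phi _.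
  by rewrite mulr_ge0// ltW// (cP phi).1.
(* [M] bounds the sum of the [r phi], since [nrm (h phi) <= 2]; more than [M / d] bumps contradict
   this. *)
have [h [r [_ h2 hr hn]]] := fam (Num.bound (M / d)) U Uk (@subset_refl _ U).
have := archi_boundP M0; rewrite ltr_pdivrMr// ltNge => /negP; apply.
apply: le_trans hn _; apply: ler_sum => phi _.
have [r0 hE] := hr phi; have := (cP phi).2 (h phi).
rewrite hE nrm_of_real ger0_norm// => /le_trans; apply.
by rewrite ler_pM2l// (cP phi).1.
Qed.

End contfun_facts.

(** * Perfect spaces *)

Lemma perfect_daugavet (R : realType) (s : scalar_kind) (K : topologicalType)
    (K0 : [set: K] !=set0) (hK : compact [set: K]) (hausK : hausdorff_space K)
    (X : completeNormedModType (scalar_field R s)) (X0 : exists x : X, x != 0) :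
  perfect_set [set: K] -> daugavet_property (contfun hK X).
Proof.
move=> /perfectTP perfK T Tc [e e0 rT]; set C := contfun hK X in T Tc e e0 rT *.
have en0 : 0 < nrm e by exact: nrm_gt0.
have [c c0 Tbound] := linear_bound Tc.
(* Because [e] is nonzero, the coefficient of [T g] is unique and so linear in [g]; boundedness of
   [T] makes it a functional. *)
have /choice[f fE] (g : C) : exists a, T g = a *: e.
  have : range T (T g) by exists g.
  by rewrite rT => -[a _ <-]; exists a.
have fl a g h : f (a *: g + h) = a * f g + f h.
  apply/eqP; rewrite -subr_eq0; have /eqP : (f (a *: g + h) - (a * f g + f h)) *: e = 0.
    by rewrite scalerBl scalerDl -scalerA -!fE linearP subrr.
  by rewrite scaler_eq0 (negbTE e0) orbF.
have [|phi phiE] := @dual_of R s C f (c / nrm e) fl.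
  by move=> g; rewrite mulrAC ler_pdivlMr// -nrmZ -fE.
have TE g : T g = sval phi g *: e by rewrite phiE.
have [||m [mE mub map]] := @supremum_approx R s [set `|T g| | g in @unit_ball _ C] c.
- by exists `|T 0|, 0 => //; rewrite /unit_ball/= normr0.
- move=> _ [g g1 <-]; split => //; rewrite norm_le_of_real (le_trans (Tbound g))//.
  by move: g1; rewrite /unit_ball/= norm_le1 => g1; rewrite ler_piMr// ltW.
rewrite /op_norm /sup_norm mE -(rmorph1 (of_real s)) -rmorphD /=.
apply: supremumE => [_ [g g1 <-]|d d0].
  rewrite rmorphD /= rmorph1 (le_trans (ler_normD _ _))// lerD//.
  by apply: mub; exists g.
(* The three thirds of [d] account for the choice of an almost norming [g], the change from [T g] to
   [T h], and the oscillation of [T g] near [k]. *)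
have d30 : 0 < d / 3 by rewrite divr_gt0.
have [_ [g g1 <-] gm] := map _ d30.
rewrite /unit_ball/= norm_le1 in g1.
have [k kmax] := nrm_contfun_attained (T g) K0.
have [v v1 vE] := unit_direction (T g k) X0.
have v1le : nrm v <= 1 by rewrite v1.
have Uk : nbhs k [set t | nrm (T g k - T g t) < d / 3].
  have := @contfun_continuous _ hK _ _ (T g) k.
  move=> /cvgrPdist_lt/(_ (of_real s (d / 3))).
  rewrite -(rmorph0 (of_real s)) ltr_of_real => /(_ d30).
  by apply: filterS => t; rewrite norm_lt_of_real.
(* The tolerance for [phi] is divided by [nrm e] because [T] is [phi] times [e]. The prescribed
   value [v] points along [T g k], so the two norms add up. *)
have [h [t [Ut h1 ht hphis]]] := weak_perturbation hausK [:: phi]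
  (perfK k) Uk v1le g1 (divr_gt0 d30 en0).
have hphi := hphis phi (or_introl erefl).
eexists; first by exists h => //; rewrite /unit_ball/= norm_le1.
rewrite -nrmE ler_of_real.
apply: le_trans (nrm_contfun_ge _ t).
have Th : nrm (T h t - T g t) < d / 3.
  apply: le_lt_trans (nrm_contfun_ge (T h - T g) t) _.
  have -> : (T h - T g) = sval phi (h - g) *: e by rewrite -TE linearB.
  by rewrite nrmZ -ltr_pdivlMr.
have vk : nrm (v + T g k) = 1 + nrm (T g).
  rewrite vE -[X in X + _]scale1r -(rmorph1 (of_real s)) -scalerDl -rmorphD/=.
  by rewrite nrmZ_real v1 mulr1 kmax ger0_norm// addr_ge0// nrm_ge0.
have : nrm (v + T g k) <= nrm (h t + T h t) + nrm (T h t - T g t) +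
    nrm (T g k - T g t).
  have -> : v + T g k = (h t + T h t) - (T h t - T g t) + (T g k - T g t).
    by rewrite ht opprB [X in _ = X + _]addrACA subrr addr0 addrACA subrr addr0.
  rewrite (le_trans (ler_nrmD _ _))// lerD2r (le_trans (ler_nrmD _ _))//.
  by rewrite nrmN.
move: gm; rewrite -nrmE ler_of_real vk => gm.
have : nrm (T g k - T g t) < d / 3 by [].
rewrite contfunDE /=; lra.
Qed.

(** * Finite-dimensional spaces *)

Section finite_dimension.
Context (R : realType) (s : scalar_kind).
Local Notation F := (scalar_field R s).
Local Notation nrmF := (@nrm R s F).
Context (X : completeNormedModType F).

Fixpoint spanned (l : seq X) : set X :=
  if l is e :: l' then [set x | exists a : F, spanned l' (x - a *: e)]
  else [set 0].

Lemma spannedP (l : seq X) x : spanned l x <->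
  exists c : nat -> F, x = \sum_(i < size l) c i *: l`_i.
Proof.
elim: l x => [|e l ih] x /=.
  split=> [->|[c ->]]; first by exists (fun=> 0); rewrite big_ord0.
  by rewrite big_ord0.
split=> [[a /ih[c xE]]|[c ->]].
  exists (fun i => if i is j.+1 then c j else a).
  by rewrite big_ord_recl /= -xE addrC subrK.
exists (c 0); apply/ih; exists (c \o succn).
by rewrite big_ord_recl /= addrAC subrr add0r.
Qed.

Lemma finite_dimensionalP :
  finite_dimensional X <-> exists l : seq X, forall x, spanned l x.
Proof.
split=> [[n [e eP]]|[l lP]].
  exists [seq e i | i <- enum 'I_n] => x; apply/spannedP.
  have [c ->] := eP x; rewrite size_map size_enum_ord.
  exists (fun i => if insub i is Some j then c j else 0).
  apply: eq_bigr => i _; rewrite (nth_map i) ?size_enum_ord//.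
  by rewrite nth_ord_enum valK.
exists (size l), (fun i => l`_i) => x; have /spannedP[c ->] := lP x.
by exists (fun i => c i).
Qed.

Definition subspace (M : set X) :=
  M 0 /\ forall a x y, M x -> M y -> M (a *: x + y).

Lemma subspaceN (M : set X) x : subspace M -> M x -> M (- x).
Proof. by move=> [M0 MD] Mx; rewrite -(addr0 (- x)) -scaleN1r; exact: MD. Qed.

Lemma spanned_subspace l : subspace (spanned l).
Proof.
elim: l => [|e l [s0 sD]] /=.
  by split=> // a x y -> ->; rewrite scaler0 addr0.
split=> [|a x y [b xb] [c yc]]; first by exists 0; rewrite scale0r subr0.
exists (a * b + c); rewrite scalerDl -scalerA opprD addrACA -scalerBr.
exact: sD.
Qed.

(** If a functional is nonzero at some [e] in [N], subtracting a multiple of [e] moves any vector of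
    [N] into its kernel; otherwise [N] already lies there. Each functional thus costs at most one
    vector. *)
Lemma common_kernel_spanned (phis : seq (dual X)) (N : set X) :
  (forall a x y, N x -> N y -> N (x - a *: y)) ->
  (forall x, N x -> (forall phi, List.In phi phis -> sval phi x = 0) -> x = 0) ->
  exists l, N `<=` spanned l.
Proof.
elim: phis N => [|phi phis ih] N NB Nker.
  by exists [::] => x Nx; apply: Nker.
have [||l lP] := ih (N `&` [set x | sval phi x = 0]).
- move=> a x y [Nx /= x0] [Ny /= y0]; split; first exact: NB.
  by rewrite /= linearB linearZ /= x0 y0 scaler0 subrr.
- move=> x [Nx x0] xphis; apply: Nker => // psi /= [<-//|]; exact: xphis.
have [[e Ne ephi]|ne] := pselect (exists2 e, N e & sval phi e != 0).
  exists (e :: l) => x Nx /=; exists (sval phi x / sval phi e).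
  apply: lP; split => /=; first exact: NB.
  by rewrite linearB linearZ /= /GRing.scale /= divfK// subrr.
exists l => x Nx; apply: lP; split => //=; apply/eqP/negPn/negP => x0.
by apply: ne; exists x.
Qed.

Lemma common_kernel_nonzero (phis : seq (dual X)) : ~ finite_dimensional X ->
  exists2 z : X, z != 0 & forall phi, List.In phi phis -> sval phi z = 0.
Proof.
move=> nfd; apply: contrapT => nz; apply: nfd; apply/finite_dimensionalP.
have [//||l lP] := @common_kernel_spanned phis setT; last by exists l => x; exact: lP.
move=> x _ xphis; apply/eqP/negPn/negP => x0.
by apply: nz; exists x.
Qed.

Lemma line_meets_sphere (x z : X) : nrm x <= 1 -> z != 0 ->
  exists t : R, nrm (x + of_real s t *: z) = 1.
Proof.
move=> x1 z0; have nz0 := nrm_gt0 z0.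
pose g t := nrm (x + of_real s t *: z).
have glip t u : g t <= g u + `|t - u| * nrm z.
  have -> : g t = nrm (x + of_real s u *: z + (of_real s (t - u) *: z)).
    by rewrite rmorphB scalerBl addrACA subrr addr0.
  by rewrite (le_trans (ler_nrmD _ _))// nrmZ_real.
have gc : continuous g.
  move=> t; apply/cvgrPdist_lt => e e0.
  have /cvgrPdist_lt/(_ (e / nrm z)) : id u @[u --> t] --> t by exact: cvg_id.
  rewrite divr_gt0// => /(_ isT); apply: filterS => u.
  rewrite ltr_pdivlMr// => tu; rewrite ltr_norml.
  have := glip t u; have := glip u t; rewrite distrC.
  by move=> *; apply/andP; split; lra.
(* At [2 / nrm z] the added vector has norm 2, so the sum has norm at least 1; at 0 the norm is at
   most 1. *)
have b0 : 0 <= 2 / nrm z by rewrite divr_ge0// nrm_ge0.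
have [||t _ gt1] := @IVT R g 0 (2 / nrm z) 1 b0; last by exists t.
- exact: continuous_subspaceT.
- have g0 : g 0 <= 1 by rewrite /g rmorph0 scale0r addr0.
  suff g1 : 1 <= g (2 / nrm z) by rewrite ge_min g0 le_max g1 orbT.
  have := ler_nrmD (x + of_real s (2 / nrm z) *: z) (- x).
  rewrite addrAC subrr add0r nrmN nrmZ_real ger0_norm// divfK ?gt_eqF// -/(g _).
  lra.
Qed.

Lemma weak_nbhs_meets_sphere (phis : seq (dual X)) (x : X) :
  ~ finite_dimensional X -> nrm x <= 1 ->
  exists2 y, nrm y = 1 & forall phi, List.In phi phis -> sval phi y = sval phi x.
Proof.
move=> nfd x1; have [z z0 zphis] := common_kernel_nonzero phis nfd.
have [t xt] := line_meets_sphere x1 z0; exists (x + of_real s t *: z) => //.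
by move=> phi /zphis phiz; rewrite linearD linearZ /= phiz scaler0 addr0.
Qed.

Definition approx_closed (M : set X) := forall x,
  (forall e : R, 0 < e -> exists2 m, M m & nrm (x - m) <= e) -> M x.

(** A vector outside a closed subspace is at positive distance [d] from it; homogeneity turns this
    into a bound on the coefficient. *)
Lemma line_bound (M : set X) e : subspace M -> approx_closed M -> ~ M e ->
  exists2 d : R, 0 < d & forall a m, M m -> d * nrmF a <= nrm (a *: e + m).
Proof.
move=> Msub Mc Me; have [M0 MD] := Msub.
have [d d0 dP] : exists2 d : R, 0 < d & forall m, M m -> d <= nrm (e - m).
  apply: contrapT => nd; apply: Me; apply: Mc => d d0.
  apply: contrapT => nm; apply: nd; exists d => // m Mm.
  by rewrite leNgt; apply/negP => /ltW dm; apply: nm; exists m.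
exists d => // a m Mm; have [->|a0] := eqVneq a 0.
  by rewrite nrm0 mulr0 nrm_ge0.
have -> : a *: e + m = a *: (e - (- a^-1) *: m).
  by rewrite scaleNr opprK scalerDr scalerA mulfV// scale1r.
rewrite nrmZ mulrC ler_wpM2l ?nrm_ge0//; apply: dP.
by rewrite -[_ *: m]addr0; exact: MD.
Qed.

(** By [line_bound], the coefficients along [e] of better and better approximations of [x] are
    Cauchy; their limit [l] puts [x - l *: e] in [M]. *)
Lemma approx_closed_add_line (M : set X) e :
  subspace M -> approx_closed M -> ~ M e ->
  approx_closed [set x | exists a : F, M (x - a *: e)].
Proof.
move=> Msub Mc Me x xap; have [M0 MD] := Msub.
have [d d0 dP] := line_bound Msub Mc Me.
pose A (r : R) : set F := [set a | exists2 m, M m & nrm (x - a *: e - m) <= r * d].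
have [||l lP] := @scalar_complete R s A.
- move=> r r0; have [|m [a ma] xm] := xap (r * d); first by rewrite mulr_gt0.
  by exists a, (m - a *: e) => //; rewrite opprB addrA subrK.
- move=> r r' a b _ _ [m Mm am] [m' Mm' bm'].
  rewrite -/(nrm _) -(ler_pM2l d0).
  apply: le_trans (dP (a - b) (m - m') _) _.
    by rewrite -[m]scale1r; apply: MD => //; exact: subspaceN.
  have -> : (a - b) *: e + (m - m') = (x - b *: e - m') - (x - a *: e - m).
    rewrite scalerBl !opprD !opprK [RHS]addrACA [x - b *: e + _]addrACA subrr.
    by rewrite add0r [- (b *: e) + _]addrC [- m' + _]addrC.
  by rewrite (le_trans (ler_nrmD _ _))// nrmN; lra.
exists l; apply: Mc => r r0.
(* With tolerance [r / k], the approximation costs [r / k * d] and replacing [a] by [l] costs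
   [2 * (r / k) * nrm e]; the two add up to [r]. *)
pose k := d + 2 * nrm e; have k0 : 0 < k.
  by rewrite ltr_pwDl// mulr_ge0// nrm_ge0.
have [|m [a ma] xm] := xap (r / k * d); first by rewrite mulr_gt0// divr_gt0.
have Aa : A (r / k) a.
  by exists (m - a *: e) => //; rewrite opprB addrA subrK.
have [m' Mm' am'] := Aa; exists m' => //.
have -> : x - l *: e - m' = (x - a *: e - m') + (a - l) *: e.
  by rewrite scalerBl addrACA addrA subrK [RHS]addrAC.
rewrite (le_trans (ler_nrmD _ _))// nrmZ.
have := lP _ _ (divr_gt0 r0 k0) Aa; rewrite -/(nrm _) => al.
have rE : r = r / k * d + 2 * (r / k) * nrm e.
  by rewrite /k; field; rewrite gt_eqF.
rewrite [leRHS]rE.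
by rewrite lerD// ler_wpM2r// nrm_ge0.
Qed.

Lemma spanned_approx_closed l : approx_closed (spanned l).
Proof.
elim: l => [|e l ih] /=.
  move=> x x0; apply: nrm_eq0; apply/eqP; rewrite eq_le nrm_ge0 andbT.
  by apply/ler_addgt0Pr => r /x0[_ ->]; rewrite subr0 add0r.
have [el|] := pselect (spanned l e); last first.
  exact: approx_closed_add_line (spanned_subspace l) ih.
have [_ sD] := spanned_subspace l.
rewrite (_ : mkset _ = spanned l)//; apply/seteqP; split => [x [a xa]|x xl].
  by rewrite -(subrK (a *: e) x) addrC; exact: sD.
by exists 0; rewrite scale0r subr0.
Qed.

(* When [e] is not in the span of [l], the coefficient of [Q x] along [e] is a
   bounded functional, and subtracting this component from [Q] leaves an
   operator into the span of [l]. *)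
Lemma spanned_functionals l (Q : X -> X) (c : R) :
  (forall a x y, Q (a *: x + y) = a *: Q x + Q y) ->
  (forall x, nrm (Q x) <= c * nrm x) -> (forall x, spanned l (Q x)) ->
  exists ps : seq (dual X * X), forall x,
    Q x = \sum_(p <- ps) sval p.1 x *: p.2.
Proof.
elim: l Q c => [|e l ih] Q c Ql Qc Qs.
  by exists [::] => x; rewrite big_nil; exact: Qs.
have lsub := spanned_subspace l; have [l0 lD] := lsub.
have [el|el] := pselect (spanned l e).
  apply: (ih Q c) => // x; have [a xa] := Qs x.
  by rewrite -(subrK (a *: e) (Q x)) addrC; exact: lD.
have [d d0 dP] := line_bound lsub (@spanned_approx_closed l) el.
have /choice[f fP] x : exists a : F, spanned l (Q x - a *: e) by exact: Qs.
have uniq a b x : spanned l (x - a *: e) -> spanned l (x - b *: e) -> a = b.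
  move=> xa xb; apply/eqP; rewrite -subr_eq0; apply/eqP/nrm_eq0/eqP.
  rewrite eq_le nrm_ge0 andbT -(pmulr_rle0 _ d0).
  have -> : 0 = nrm ((a - b) *: e + ((x - a *: e) - (x - b *: e))).
    rewrite opprD opprK addrACA subrr add0r scalerBl addrACA subrr addNr addr0.
    by rewrite nrm0.
  by apply: dP; rewrite -[x - a *: e]scale1r; apply: lD => //; exact: subspaceN.
have fl a x y : f (a *: x + y) = a * f x + f y.
  apply: (uniq _ _ (Q (a *: x + y))); first exact: fP.
  rewrite Ql scalerDl -scalerA opprD addrACA -scalerBr.
  by apply: lD; exact: fP.
have fb x : nrmF (f x) <= c / d * nrm x.
  rewrite mulrAC ler_pdivlMr// mulrC (le_trans _ (Qc x))//.
  by have := dP (f x) _ (fP x); rewrite addrC subrK.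
have [phi phiE] := dual_of fl fb.
have [|||ps psP] := ih (fun x => Q x - f x *: e) (c + c / d * nrm e).
- move=> a x y; rewrite Ql fl scalerDl -scalerA opprD addrACA.
  by rewrite -scalerBr.
- move=> x; rewrite (le_trans (ler_nrmD _ _))// nrmN nrmZ mulrDl lerD//.
  by rewrite mulrAC ler_wpM2r// nrm_ge0.
- exact: fP.
exists ((phi, e) :: ps) => x; rewrite big_cons /= phiE -psP.
by rewrite addrC subrK.
Qed.

(** The identity is a finite sum of functionals times fixed vectors, so small values of these
    functionals force a small norm. *)
Lemma finite_dimensional_weak_nbhs : finite_dimensional X ->
  forall d : R, 0 < d -> exists (phis : seq (dual X)) (r : R), 0 < r /\
    forall y, (forall phi, List.In phi phis -> nrmF (sval phi y) < r) -> nrm y <= d.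
Proof.
move=> /finite_dimensionalP[l lP] d d0.
have [//||//|ps psP] := @spanned_functionals l id 1.
  by move=> x; rewrite mul1r.
pose M := 1 + \sum_(p <- ps) nrm p.2.
have M0 : 0 < M by rewrite ltr_pwDl// sumr_ge0// => p _; exact: nrm_ge0.
exists [seq p.1 | p <- ps], (d / M); split; first exact: divr_gt0.
move=> y yps; rewrite (psP y) (le_trans (ler_nrm_sum _ _))//.
apply: (@le_trans _ _ (\sum_(p <- ps) d / M * nrm p.2)).
  move: yps; elim: (ps) => [|p ps' ih] yps; first by rewrite !big_nil.
  rewrite !big_cons lerD//; last by apply: ih => phi phiin; apply: yps; right.
  by rewrite nrmZ ler_wpM2r ?nrm_ge0// ltW//; apply: yps; left.
rewrite -mulr_sumr mulrAC ler_pdivrMr// ler_wpM2l ?(ltW d0)//.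
by rewrite /M lerDr.
Qed.

(** After division by [r ^+ 2], the left side of the main inequality is at least
    [1 + t + t ^+ 2 / 4], the right side at most [1 + t ^+ 2 / 8 + t - t ^+ 2]. *)
Lemma no_first_order_growth (t r A M S : R) : 0 < t -> t <= 1 -> 0 < r ->
  1 + t / 2 <= A -> M - t ^+ 2 / 16 * M < r ^+ 2 -> (r * A) ^+ 2 <= M + S ->
  S <= t * (1 - t) * r ^+ 2 -> False.
Proof.
move=> t0 t1 r0 A1 Mr rA Sr.
have rt0 : 0 < r ^+ 2 * t ^+ 2 by rewrite mulr_gt0// exprn_gt0.
have t21 : t ^+ 2 <= 1 by rewrite expr_le1// ltW.
have rt1 : 0 <= r ^+ 2 * t ^+ 2 * (1 - t ^+ 2).
  by rewrite mulr_ge0 ?subr_ge0// ltW.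
have Ln : M <= r ^+ 2 * (1 + t ^+ 2 / 8).
  rewrite leNgt; apply/negP => h.
  have h2 : r ^+ 2 * (1 + t ^+ 2 / 8) * (1 - t ^+ 2 / 16) < M * (1 - t ^+ 2 / 16).
    by rewrite ltr_pM2r//; lra.
  by lra.
have rA2 : (r * (1 + t / 2)) ^+ 2 <= (r * A) ^+ 2.
  by rewrite !expr2 ler_pM// ?ler_pM2l ?mulr_ge0 ?addr_ge0 ?divr_ge0// ltW.
lra.
Qed.

(* Compare the norm with the Euclidean norm on the span of [u] and [v]: at a
   point where the ratio of the two is almost maximal, adding a small vector
   Euclidean-orthogonal to it changes the norm only to second order. *)
Lemma rotations_one_dimensional :
  (forall x y : X, nrm x = 1 -> nrm y = 1 -> forall e : R, 0 < e ->
    exists2 t, nrmF t = 1 & 2 - e <= nrm (x + t *: y)) ->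
  forall u v : X, u != 0 -> exists a : F, v = a *: u.
Proof.
move=> rot u v u0; apply: contrapT => nv.
have single (e x : X) : spanned [:: e] x <-> exists a : F, x = a *: e.
  split=> [[a /= /eqP]|[a ->]]; first by rewrite subr_eq0 => /eqP ->; exists a.
  by exists a; rewrite /= subrr.
have vu : ~ spanned [:: u] v by move/single.
have uv : ~ spanned [:: v] u.
  move=> /single[a ua]; apply: nv; exists a^-1.
  rewrite ua scalerA mulVf ?scale1r//; apply: contra_neq u0 => a0.
  by rewrite ua a0 scale0r.
have [d d0 dP] := line_bound (spanned_subspace _) (@spanned_approx_closed _) vu.
have [d' d'0 dP'] := line_bound (spanned_subspace _) (@spanned_approx_closed _) uv.
pose N (a b : F) := nrmF a ^+ 2 + nrmF b ^+ 2.
pose w (a b : F) := a *: u + b *: v.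
have N0 a b : 0 <= N a b by rewrite addr_ge0// sqr_ge0.
have upper a b : nrm (w a b) ^+ 2 <= (nrm u ^+ 2 + nrm v ^+ 2) * N a b.
  have : nrm (w a b) <= nrmF a * nrm u + nrmF b * nrm v.
    by rewrite -!nrmZ; exact: ler_nrmD.
  rewrite /N; move: (nrm (w a b)) (nrm_ge0 (w a b)) => g g0 gle.
  have : g ^+ 2 <= (nrmF a * nrm u + nrmF b * nrm v) ^+ 2 by rewrite !expr2 ler_pM.
  have := sqr_ge0 (nrmF a * nrm v - nrmF b * nrm u); lra.
(* The distances [d'] and [d] control the two coordinates of [w a b] by its norm; together with
   [upper] this makes the two norms equivalent. *)
pose Q0 := d'^-1 ^+ 2 + d^-1 ^+ 2.
have Q00 : 0 < Q0 by rewrite addr_gt0// exprn_gt0// invr_gt0.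
have lower a b : N a b <= Q0 * nrm (w a b) ^+ 2.
  have aw : nrmF a <= d'^-1 * nrm (w a b).
    rewrite mulrC ler_pdivlMr// mulrC; apply: dP'; apply/single; by exists b.
  have bw : nrmF b <= d^-1 * nrm (w a b).
    rewrite mulrC ler_pdivlMr// mulrC /w addrC; apply: dP; apply/single; by exists a.
  by rewrite /Q0 mulrDl -!exprMn !expr2 lerD// ler_pM ?nrm_ge0.
pose S := [set nrm (w ab.1 ab.2) ^+ 2 / N ab.1 ab.2 | ab in
  [set ab : F * F | 0 < N ab.1 ab.2]].
have Ssup : has_sup S.
  split.
    exists (nrm (w 1 0) ^+ 2 / N 1 0), (1, 0) => //=.
    by rewrite /N nrm1 nrm0 expr1n expr0n addr0.
  exists (nrm u ^+ 2 + nrm v ^+ 2) => _ [[a b] /= ab <-].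
  by rewrite ler_pdivrMr.
pose L := sup S.
have SL a b : 0 < N a b -> nrm (w a b) ^+ 2 <= L * N a b.
  move=> ab; rewrite -ler_pdivrMr//; apply: ub_le_sup; first by case: Ssup.
  by exists (a, b).
have L0 : 0 < L.
  have N10 : N 1 0 = 1 by rewrite /N nrm1 nrm0 expr1n expr0n addr0.
  have := SL 1 0; rewrite N10 mulr1 /w scale1r scale0r addr0 => /(_ ltr01).
  by apply: lt_le_trans; rewrite exprn_gt0// nrm_gt0.
pose q := L * Q0; have q0 : 0 < q by exact: mulr_gt0.
(* This [t] solves [t * (1 - t) = t ^+ 2 * q]; with [n <= Q0 * p ^+ 2] below, the second-order term
   is then within the bound required by [no_first_order_growth]. *)
pose t := (1 + q)^-1; have t0 : 0 < t by rewrite invr_gt0 addr_gt0.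
have tq : t * (1 + q) = 1 by rewrite mulVf// gt_eqF// addr_gt0.
have t1 : t <= 1 by rewrite /t invf_le1 ?lerDl ?ltW// addr_gt0.
have eta0 : 0 < t ^+ 2 / 16 * L by rewrite mulr_gt0// divr_gt0// exprn_gt0.
have [_ [[a b] /= ab <-]] := sup_adherent eta0 Ssup; rewrite -/L => abL.
have [a' [b' [Nab' orth]]] := scalar_orthogonal a b.
have toN c c' : `|c| ^+ 2 + `|c'| ^+ 2 = of_real s (N c c').
  by rewrite rmorphD !rmorphXn /= !nrmE.
rewrite !toN in Nab'; have {}Nab' := can_inj (of_realK s) Nab'.
have {}orth z : N (a + z * a') (b + z * b') = (1 + nrmF z ^+ 2) * N a b.
  apply: (can_inj (of_realK s)); have := orth z; rewrite !toN => ->.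
  by rewrite rmorphM; congr (_ * _); rewrite rmorphD rmorph1 rmorphXn /= nrmE.
have pos c c' : 0 < N c c' -> 0 < nrm (w c c').
  move=> cc'; rewrite lt_neqAle nrm_ge0 andbT eq_sym; apply/eqP => wc.
  by have := lower c c'; rewrite wc expr0n mulr0 leNgt cc'.
have x0 := pos _ _ ab; have y0 : 0 < nrm (w a' b') by apply: pos; rewrite Nab'.
set x := w a b in x0 abL; set y := w a' b' in y0.
have unit_of (z : X) : 0 < nrm z -> nrm (of_real s (nrm z)^-1 *: z) = 1.
  by move=> z0; rewrite nrmZ_real ger0_norm ?invr_ge0 ?nrm_ge0// mulVf ?gt_eqF.
have [//|th th1 thP] := rot _ _ (unit_of x x0) (unit_of y y0) (t / 2).
  by rewrite divr_gt0.
pose r := nrm x; pose p := nrm y; pose n := N a b.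
rewrite -/r -/p in thP x0 y0.
(* The coefficient is chosen so that [x + z *: y] is [r] times the sum of the unit vector along [x]
   and [t] times the rotated unit vector along [y]. *)
pose z : F := of_real s (t * r / p) * th.
have nz : nrmF z = t * r / p.
  by rewrite nrmM th1 mulr1 nrm_of_real ger0_norm// divr_ge0 ?mulr_ge0// ltW.
pose A := nrm (of_real s r^-1 *: x + of_real s t *: (th *: (of_real s p^-1 *: y))).
(* Increasing the coefficient of the rotated vector from [t] to 1 changes the norm by at most
   [1 - t], and the full sum has norm at least [2 - t / 2]. *)
have A_ge : 1 + t / 2 <= A.
  have : nrm (of_real s r^-1 *: x + th *: (of_real s p^-1 *: y)) <= A + (1 - t).
    have nth : nrm (th *: (of_real s p^-1 *: y)) = 1.
      by rewrite nrmZ th1 mul1r unit_of.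
    have -> : of_real s r^-1 *: x + th *: (of_real s p^-1 *: y) =
        (of_real s r^-1 *: x + of_real s t *: (th *: (of_real s p^-1 *: y))) +
        of_real s (1 - t) *: (th *: (of_real s p^-1 *: y)).
      by rewrite -addrA -scalerDl -rmorphD /= [t + _]addrC subrK rmorph1 scale1r.
    rewrite (le_trans (ler_nrmD _ _))// lerD// nrmZ_real nth mulr1.
    by rewrite ger0_norm// subr_ge0.
  lra.
have wE : w (a + z * a') (b + z * b') = x + z *: y.
  by rewrite /w /x /y /w !scalerDl scalerDr !scalerA addrACA.
have xyE : x + z *: y = of_real s r *: (of_real s r^-1 *: x +
    of_real s t *: (th *: (of_real s p^-1 *: y))).
  rewrite [RHS]scalerDr !scalerA -(rmorphM (of_real s)) mulfV ?gt_eqF// rmorph1 scale1r.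
  congr (_ + _ *: _); rewrite /z !rmorphM /=; ring.
have n0 : 0 < n by [].
have main : (r * A) ^+ 2 <= L * ((1 + (t * r / p) ^+ 2) * n).
  have -> : r * A = nrm (w (a + z * a') (b + z * b')).
    by rewrite wE xyE nrmZ_real ger0_norm// ltW.
  by rewrite -nz -orth; apply: SL; rewrite orth mulr_gt0// ltr_pwDl// sqr_ge0.
have nQ : n <= Q0 * p ^+ 2 by rewrite /n -Nab'; exact: lower.
rewrite ltr_pdivlMr// -/r -/n in abL.
apply: (@no_first_order_growth t r A (L * n) (L * ((t * r / p) ^+ 2 * n))) => //.
- by move: abL; rewrite mulrBl mulrA.
- by move: main; rewrite mulrDl mul1r mulrDr.
have -> : t * (1 - t) = t ^+ 2 * q by rewrite -[X in X - t]tq; ring.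
have -> : L * ((t * r / p) ^+ 2 * n) = t ^+ 2 * r ^+ 2 * (L * (n / p ^+ 2)).
  by field; rewrite gt_eqF.
rewrite [leRHS]mulrAC ler_pM2l ?mulr_gt0// ?exprn_gt0// /q ler_pM2l//.
by rewrite ler_pdivrMr// exprn_gt0.
Qed.

End finite_dimension.

(** * Isolated points *)

Section isolated_point.
Context (R : realType) (s : scalar_kind).
Local Notation F := (scalar_field R s).
Local Notation nrmF := (@nrm R s F).
Context (K : topologicalType) (hK : compact [set: K]).
Hypothesis hausK : hausdorff_space K.
Context (X : completeNormedModType F).
Local Notation C := (contfun hK X).

Lemma point_mass (k : K) : open [set k] -> exists J : X -> C,
  forall x t, J x t = if t == k then x else 0.
Proof.
move=> ok; suff Jc (x : X) : continuous (fun t : K => if t == k then x else 0).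
  by exists (fun x => mkcontfun hK (Jc x)).
move=> t A At; have := nbhs_singleton At.
have [->|tk] := eqVneq t k => Ax.
  by apply: (@filterS _ _ _ [set k]) => [_ ->/=|]; [rewrite eqxx|exact: open_nbhs_nbhs].
apply: (@filterS _ _ _ (~` [set k])) => [u /= /eqP/negbTE ->//|].
apply: open_nbhs_nbhs; split; last by apply/eqP.
exact/closed_openC/accessible_closed_set1/hausdorff_accessible.
Qed.

Lemma point_mass_dual (k : K) (J : X -> C) (phi : dual C) :
  (forall x t, J x t = if t == k then x else 0) ->
  exists psi : dual X, forall x, sval psi x = sval phi (J x).
Proof.
move=> JE; have [c c0 phic] := dual_bound phi.
apply: (@dual_of _ _ _ (fun x => sval phi (J x)) c) => [a x y|x].
  rewrite (_ : J _ = a *: J x + J y) ?linearP//; apply: contfunP => t.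
  by rewrite contfunDE contfunZE !JE; case: ifP; rewrite ?scaler0 ?addr0.
rewrite (le_trans (phic _))// ler_pM2l//.
apply: nrm_contfun_le => [|t]; first exact: nrm_ge0.
by rewrite JE; case: ifP => // _; rewrite nrm0 nrm_ge0.
Qed.

Lemma nrm_point_mass (k : K) (J : X -> C) x :
  (forall x t, J x t = if t == k then x else 0) -> nrm (J x) = nrm x.
Proof.
move=> JE; apply/eqP; rewrite eq_le; apply/andP; split.
  apply: nrm_contfun_le => [|t]; first exact: nrm_ge0.
  by rewrite JE; case: ifP => // _; rewrite nrm0 nrm_ge0.
by have := nrm_contfun_ge (J x) k; rewrite JE eqxx.
Qed.

Lemma contfun_super_alternative_daugavet : [set: K] !=set0 ->
  ~ finite_dimensional X -> super_alternative_daugavet_property X ->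
  super_alternative_daugavet_property C.
Proof.
move=> K0 nfd /super_alternative_daugavetP sadX.
apply/super_alternative_daugavetP => f g0 f1 g01 phis d e d0 e0.
have [k fk] := nrm_contfun_attained f K0; rewrite f1 in fk.
have g0le t : nrm (g0 t) <= 1 by rewrite -g01; exact: nrm_contfun_ge.
have [ok|nok] := pselect (open [set k]).
  have [J JE] := point_mass ok.
  have /choice[psi psiE] (phi : dual C) := point_mass_dual phi JE.
  (* The norm of [g0 k] may be below 1, so it is replaced by a unit vector [y1] with the same values
     under the functionals; a [y] weakly close to [y1] is then close to [g0 k]. *)
  have [y1 y11 y1psi] := weak_nbhs_meets_sphere (map psi phis) nfd (g0le k).
  have [y [t [yle t1 ypsi xy]]] :=
    sadX _ _ (esym fk) y11 (map psi phis) d e d0 e0.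
  have gE u : (g0 + J (y - g0 k)) u = if u == k then y else g0 u.
    rewrite contfunDE JE; case: eqVneq => [->|_]; last by rewrite addr0.
    by rewrite addrC subrK.
  exists (g0 + J (y - g0 k)), t; split => //.
  - apply: nrm_contfun_le => // u; rewrite gE; case: ifP => // _; exact: g0le.
  - move=> phi phiin; rewrite addrAC subrr add0r -psiE.
    have psiin : List.In (psi phi) (map psi phis) by exact: List.in_map.
    by rewrite linearB /= -(y1psi _ psiin) -linearB; exact: ypsi.
  - apply: le_trans (nrm_contfun_ge _ k).
    by rewrite contfunDE contfunZE gE eqxx.
have Uk : nbhs k [set t | nrm (f k - f t) < e].
  have := @contfun_continuous _ hK _ _ f k.
  move=> /cvgrPdist_lt/(_ (of_real s e)).
  rewrite -(rmorph0 (of_real s)) ltr_of_real => /(_ e0).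
  by apply: filterS => t; rewrite norm_lt_of_real.
(* The value prescribed near [k] is [f k] itself, so at [t] the sum has norm close to
   [2 * nrm (f k) = 2]. *)
have [||g [t [Ut g1 gt gphi]]] :=
    @weak_perturbation _ _ _ _ _ hausK k _ (f k) g0 phis d nok Uk _ _ d0.
- by rewrite -fk.
- by rewrite g01.
exists g, 1; split => //; first exact: nrm1.
apply: le_trans (nrm_contfun_ge _ t).
rewrite contfunDE contfunZE gt scale1r.
have : nrm (f k + f k) <= nrm (f t + f k) + nrm (f k - f t).
  have -> : f k + f k = (f t + f k) + (f k - f t).
    by rewrite addrAC [f t + _]addrC subrK.
  exact: ler_nrmD.
have -> : f k + f k = of_real s 2 *: f k.
  by rewrite rmorphMn rmorph1 scaler_nat mulr2n.
rewrite nrmZ_real -fk ger0_norm// mulr1.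
by have : nrm (f k - f t) < e := Ut; lra.
Qed.

Lemma scalar_super_alternative_daugavet (k : K) : [set: K] = [set k] ->
  isometrically_isomorphic X (scalar_field R s)^o ->
  super_alternative_daugavet_property C.
Proof.
move=> Kk [J _ Jn]; apply/super_alternative_daugavetP => f g f1 g1 phis d e d0 e0.
have nk (h : C) : nrm h = nrmF (J (h k)).
  have [|t ->] := nrm_contfun_attained h; first by exists k.
  have -> : t = k by have : [set: K] t by []; rewrite Kk.
  by rewrite /nrm Jn.
rewrite nk in f1; have g1' := g1; rewrite nk in g1'.
have gn0 : J (g k) != 0 by apply/eqP => Jg; move: g1'; rewrite Jg nrm0; lra.
(* Rotated by this quotient of unit scalars, [g] coincides with [f], and the sum is twice [f]. *)
exists g, (J (f k) / J (g k)); split.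
- by rewrite g1.
- by rewrite nrmM nrmV f1 g1' invr1 mulr1.
- by move=> phi _; rewrite subrr linear0 nrm0.
rewrite nk contfunDE contfunZE linearD linearZ /= /GRing.scale /= divfK//.
have -> : J (f k) + J (f k) = of_real s 2 * J (f k).
  by rewrite rmorphMn rmorph1 mulr_natl mulr2n.
by rewrite nrmM nrm_of_real f1 ger0_norm//; lra.
Qed.

Lemma super_alternative_daugavet_fiber (k : K) : open [set k] ->
  super_alternative_daugavet_property C -> super_alternative_daugavet_property X.
Proof.
move=> ok /super_alternative_daugavetP sadC.
apply/super_alternative_daugavetP => x y0 x1 y01 phis d e d0 e0.
have [J JE] := point_mass ok.
have /choice[psi psiE] (phi : dual X) := @evaluation_dual _ _ _ hK _ phi k.
(* A tolerance of at most 1/2 forces the norm to be attained at [k]: elsewhere [J x] vanishes and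
   the sum has norm at most 1. *)
have [|||g [t [g1 t1 gphi fg]]] :=
  sadC (J x) (J y0) _ _ (map psi phis) d (Num.min e 2^-1) d0.
- by rewrite (nrm_point_mass _ JE).
- by rewrite (nrm_point_mass _ JE).
- by rewrite lt_min e0 invr_gt0 ltr0n.
exists (g k), t; split => //.
- by apply: le_trans g1; exact: nrm_contfun_ge.
- move=> phi phiin; have := gphi _ (List.in_map psi _ _ phiin).
  by rewrite psiE contfunDE contfunNE JE eqxx.
have [|u uE] := nrm_contfun_attained (J x + t *: g); first by exists k.
have ee : Num.min e 2^-1 <= e by rewrite ge_min lexx.
have e2 : Num.min e 2^-1 <= 2^-1 :> R by rewrite ge_min lexx orbT.
move: fg; rewrite uE contfunDE contfunZE JE; case: eqVneq => [->|_].
  by lra.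
rewrite add0r nrmZ t1 mul1r => ?.
have : nrm (g u) <= 1 by apply: le_trans g1; exact: nrm_contfun_ge.
by lra.
Qed.

Lemma finite_dimensional_singleton (k : K) : open [set k] ->
  (exists x : X, x != 0) -> finite_dimensional X ->
  super_alternative_daugavet_property C -> [set: K] = [set k].
Proof.
move=> ok X0 fd /super_alternative_daugavetP sadC.
apply/seteqP; split => // k1 _ /=; apply: contrapT => k1k.
have [J JE] := point_mass ok.
have [x x1 _] := unit_direction 0 X0.
have cx : continuous (fun _ : K => x) by move=> t; exact: cvg_cst.
(* [J x] and [g0] have disjoint supports; the second point [k1] gives [g0] norm 1. *)
pose g0 : C := mkcontfun hK cx - J x.
have g0E t : g0 t = if t == k then 0 else x.
  rewrite contfunDE contfunNE mkcontfunE JE.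
  by case: ifP => _; rewrite ?subrr ?subr0.
have g01 : nrm g0 = 1.
  apply/eqP; rewrite eq_le; apply/andP; split.
    apply: nrm_contfun_le => // t; rewrite g0E.
    by case: ifP => _; rewrite ?nrm0// x1.
  have := nrm_contfun_ge g0 k1; rewrite g0E ifF ?x1//.
  by apply/negbTE/eqP.
have [|phis [r [r0 rP]]] := finite_dimensional_weak_nbhs fd (d := 4^-1).
  by rewrite invr_gt0.
have /choice[psi psiE] (phi : dual X) := @evaluation_dual _ _ _ hK _ phi k.
(* At [k] the sum has norm at most [1 + 1/4], elsewhere at most 1, while the property gives at least
   3/2. *)
have [||g [t [g1 t1 gphi fg]]] := sadC (J x) g0 _ g01 (map psi phis) r 2^-1 r0.
- by rewrite (nrm_point_mass _ JE).
- by rewrite invr_gt0.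
have gk : nrm (g k) <= 4^-1.
  apply: rP => phi phiin; have := gphi _ (List.in_map psi _ _ phiin).
  by rewrite psiE contfunDE contfunNE g0E eqxx subr0.
have [|u uE] := nrm_contfun_attained (J x + t *: g); first by exists k.
move: fg; rewrite uE contfunDE contfunZE JE; case: eqVneq => [->|_] fg.
  have := ler_nrmD x (t *: g k); rewrite nrmZ t1 mul1r x1.
  by lra.
rewrite add0r nrmZ t1 mul1r in fg.
have : nrm (g u) <= 1 by apply: le_trans g1; exact: nrm_contfun_ge.
by lra.
Qed.

(** In finite dimension a weakly close [y'] is norm close to [y], so [y] itself has a rotation whose
    sum with [x] has norm almost 2. Hence every vector is a multiple of one unit vector [u], and the
    coefficient is an isometry. *)
Lemma finite_dimensional_scalar : (exists x : X, x != 0) ->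
  finite_dimensional X -> super_alternative_daugavet_property X ->
  isometrically_isomorphic X (scalar_field R s)^o.
Proof.
move=> X0 fd /super_alternative_daugavetP sadX.
have [u u1 _] := unit_direction 0 X0.
have u0 : u != 0 by apply/eqP => uE; move: u1; rewrite uE nrm0; lra.
have /choice[f fE] : forall v, exists a : F, v = a *: u.
  move=> v; apply: rotations_one_dimensional => // x y x1 y1 e e0.
  have e20 : 0 < e / 2 by rewrite divr_gt0.
  have [phis [r [r0 rP]]] := finite_dimensional_weak_nbhs fd e20.
  have [y' [t [y'1 t1 y'y xy]]] := sadX x y x1 y1 phis r (e / 2) r0 e20.
  exists t => //; have := rP (y' - y) y'y.
  have : nrm (x + t *: y') <= nrm (x + t *: y) + nrm (y' - y).
    have -> : x + t *: y' = (x + t *: y) + t *: (y' - y).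
      by rewrite scalerBr [t *: y' - _]addrC addrA addrK.
    by rewrite (le_trans (ler_nrmD _ _))// nrmZ t1 mul1r.
  by lra.
have uinj : injective (fun a : F => a *: u).
  move=> a b /= /eqP; rewrite -subr_eq0 -scalerBl scaler_eq0 (negbTE u0) orbF.
  by rewrite subr_eq0 => /eqP.
have [|g gE] := @linear_of R s X F^o f.
  move=> a x y; apply: uinj; rewrite /= -fE {1}(fE x) {1}(fE y).
  by rewrite scalerDl -scalerA.
exists g.
  exists (fun a : F => a *: u) => [x|a]; first by rewrite gE -fE.
  by rewrite gE; apply: uinj; rewrite /= -fE.
move=> x; rewrite gE {2}(fE x) normrZ.
by have /norm_eq1 -> := u1; rewrite mulr1.
Qed.

End isolated_point.

Theorem theorem5p19 (R : realType) (s : scalar_kind)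
    (K : topologicalType) (K_nonempty : [set: K] !=set0)
    (K_compact : compact [set: K]) (K_hausdorff : hausdorff_space K)
    (X : completeNormedModType (scalar_field R s))
    (X_nonzero : exists x : X, x != 0) :
  (perfect_set [set: K] -> daugavet_property (contfun K_compact X)) /\
  (~ perfect_set [set: K] ->
     (super_alternative_daugavet_property (contfun K_compact X) <->
        (~ finite_dimensional X /\ super_alternative_daugavet_property X) \/
        ((exists k : K, [set: K] = [set k]) /\
         isometrically_isomorphic X (scalar_field R s)^o))).
Proof.
split; first exact: perfect_daugavet.
move=> nperf; have [k ok] : exists k : K, open [set k].
  apply: contrapT => nok; apply: nperf; apply/perfectTP => k ok.
  by apply: nok; exists k.
split=> [sadC|[[nfd sadX]|[[k1 Kk1] XF]]].
- have sadX := super_alternative_daugavet_fiber K_hausdorff ok sadC.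
  have [fd|nfd] := pselect (finite_dimensional X); last by left.
  right; split; last exact: finite_dimensional_scalar.
  by exists k; exact: (finite_dimensional_singleton K_hausdorff ok X_nonzero fd sadC).
- exact: contfun_super_alternative_daugavet.
- exact: (scalar_super_alternative_daugavet Kk1 XF).
Qed.
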